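(* Let $\lambda\Vdash n$ be a strict partition with $\ell=\ell(\lambda)$. The vectors $\mathcal F^{\delta}\theta_{\mathcal T}\in\widehat U^\lambda$, parameterized by the tuples $\delta$ and the standard (unbarred) tableaux $\mathcal T$ of shape $\lambda$, form a basis of the irreducible representation $V^\lambda$ of the spin symmetric group algebra $\mathbb C\mathfrak S_n^-$ associated with $\lambda$ (that is, they are a basis of a $\mathbb C\mathfrak S_n^-$-submodule of $\widehat U^\lambda$ isomorphic to $V^\lambda$). The action of the generators $t_a$, $1\le a\le n-1$, in this basis is determined by $t_ac_b=-c_bt_a$ for all $a,b$, the right $\mathcal{C}l^\lambda_{n-\ell}$-module structure of $E^\lambda=\mathrm{span}\{\mathcal F^\delta\}$, and the formulas $$t_a\,\theta_{\mathcal T}=\frac{\sqrt2\,\big(\kappa_a(\mathcal T)\,c_{a^{\mathcal T}}-\kappa_{a+1}(\mathcal T)\,c_{(a+1)^{\mathcal T}}\big)}{\kappa_a(\mathcal T)^2-\kappa_{a+1}(\mathcal T)^2}\,\theta_{\mathcal T}+\varepsilon_a(\mathcal T)\,\mathcal Y_a(\mathcal T)\,\theta_{s_a\mathcal T},$$ where $\theta_{s_a\mathcal T}=0$ if $s_a\mathcal T$ is not standard, and $\varepsilon_a(\mathcal T)=(-1)^{i_a(i_{a+1}+1)+i_{a+2}+\dots+i_n}$ or $\varepsilon_a(\mathcal T)=(-1)^{(i_a+1)(i_{a+1}+1)+i_{a+2}+\dots+i_n}$, depending on whether the length of $d(s_a\mathcal T)$ is greater or smaller than that of $d(\mathcal 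T)$.
   Context: All algebras are over $\mathbb C$, $i=\sqrt{-1}$ (when not carrying a subscript). The spin symmetric group algebra $\mathbb C\mathfrak S_n^-$ is the superalgebra generated by odd $t_1,\dots,t_{n-1}$ with $t_a^2=1$, $t_at_{a+1}t_a=t_{a+1}t_at_{a+1}$, $t_at_b=-t_bt_a$ for $|a-b|>1$. The Clifford superalgebra $\mathcal{C}l_n$ is generated by odd $c_1,\dots,c_n$ with $c_a^2=-1$, $c_ac_b=-c_bc_a$ for $a\ne b$. The Sergeev superalgebra is the graded tensor product $\mathcal S_n=\mathbb C\mathfrak S_n^-\otimes\mathcal{C}l_n$, so $t_ac_b=-c_bt_a$ for all $a,b$. Put $s_a=\frac1{\sqrt2}t_a(c_{a+1}-c_a)$ (these satisfy the relations of adjacent transpositions) and $y_a=\frac{c_{a+1}-c_a}{\sqrt2}$, so $t_a=y_as_a$. Modules are $\mathbb Z_2$-graded, irreducible means having no nonzero proper graded submodules, and isomorphisms are considered up to parity shift. A strict partition $\lambda\Vdash n$ is $\lambda=(\lambda_1>\dots>\lambda_\ell>0)$ with sum $n$; $\ell(\lambda)=\ell$. Its shifted Young diagram has boxes $(i,j)$ with $1\le i\le\ell$, $i\le j\le i+\lambda_i-1$; boxes $(i,i)$ are diagonal. A standard tableau of shape $\lambda$ is a bijective filling of the boxes by $1,\dots,n$ with entries increasing along rows and down columns. If $a$ occupies the box $(i,j)$ of $\mathcal T$ and $\sigma=j-i$, put $\kappa_a(\mathcal T)=\sqrt{\sigma(\sigma+1)}$. Put $\mathcal Y_a(\mathcal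 T)=\sqrt{A(\kappa_a(\mathcal T),\kappa_{a+1}(\mathcal T))}$ with $A(u,v)=1-\frac1{(u-v)^2}-\frac1{(u+v)^2}$. $s_a\mathcal T$ is obtained from $\mathcal T$ by swapping $a$ and $a+1$. $\widehat U^\lambda$ is the $\mathcal S_n$-module which is free over $\mathcal{C}l_n$ on vectors $v_{\mathcal T}$ indexed by the standard tableaux of shape $\lambda$, with $$s_av_{\mathcal T}=\Big(\frac1{\kappa_{a+1}(\mathcal T)-\kappa_a(\mathcal T)}+\frac{c_ac_{a+1}}{\kappa_{a+1}(\mathcal T)+\kappa_a(\mathcal T)}\Big)v_{\mathcal T}+\mathcal Y_a(\mathcal T)v_{s_a\mathcal T},$$ where $v_{s_a\mathcal T}=0$ if $s_a\mathcal T$ is not standard. It is (known) a direct sum of copies of a simple $\mathcal S_n$-module $U^\lambda$. Known facts: $\mathbb C\mathfrak S_n^-$ is semisimple, its simple modules $V^\lambda$ are parameterized by $\lambda\Vdash n$, $V^\lambda$ being the simple module (unique up to isomorphism and parity shift) occurring in the restriction of $U^\lambda$ to $\mathbb C\mathfrak S_n^-$; and $\dim V^\lambda=2^{\lceil (n-\ell(\lambda))/2\rceil}g_\lambda$, where $g_\lambda$ is the number of standard tableaux of shape $\lambda$. $\mathcal R^\lambda$ is the row-tableau, with $1,\dots,n$ written consecutively by rows from left to right, starting from the top row; $d(\mathcal T)\in\mathfrak S_n$ is the unique permutation with $\mathcal T=d(\mathcal T)\mathcal R^\lambda$ (acting on entries); $b^{\mathcal T}:=d(\mathcal T)^{-1}(b)$.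 The row-word of $\mathcal T$ is the sequence of its entries read by rows from left to right, starting from the top row. For $b=2,\dots,n$, $i_b=i_b(\mathcal T)$ is the number of $b'<b$ occurring after $b$ in the row-word of $\mathcal T$; also $i_1=0$. Then $d(\mathcal T)=\prod_{b=2,\dots,n}^{\longrightarrow}(s_{b-1}s_{b-2}\cdots s_{b-i_b})$ (factors ordered by increasing $b$ from left to right, a factor being $1$ if $i_b=0$) is a reduced decomposition; writing it as $d(\mathcal T)=s_{a_1}\cdots s_{a_r}$, put $\theta_{\mathcal T}=y_{a_r}\cdots y_{a_1}v_{\mathcal T}\in\widehat U^\lambda$. Let $b_1<\dots<b_{n-\ell}$ be the non-diagonal entries of $\mathcal R^\lambda$, and let $\mathcal{C}l^\lambda_{n-\ell}\subset\mathcal{C}l_n$ be the subalgebra generated by $c_{b_1},\dots,c_{b_{n-\ell}}$. Write $n-\ell=2p$ or $n-\ell=2p+1$. For $a=1,\dots,p$ put $\mathcal F_a^{+}=1+i\,c_{b_{2a-1}}c_{b_{2a}}$ and $\mathcal F_a^{-}=c_{b_{2a-1}}+i\,c_{b_{2a}}$. If $n-\ell=2p$, then $\delta=(\delta_1,\dots,\delta_p)\in\{+,-\}^p$ and $\mathcal F^\delta=\mathcal F_1^{\delta_1}\cdots\mathcal F_p^{\delta_p}$. If $n-\ell=2p+1$, then $\delta=(\delta_1,\dots,\delta_p,\alpha)$ with $\delta_a\in\{+,-\}$, $\alpha\in\{0,1\}$, and $\mathcal F^\delta=\mathcal F_1^{\delta_1}\cdots\mathcal F_p^{\delta_p}c_{b_{2p+1}}^{\alpha}$.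 The span $E^\lambda$ of the $\mathcal F^\delta$ is a right $\mathcal{C}l^\lambda_{n-\ell}$-module under right multiplication: $\mathcal F^+_ac_{b_{2a-1}}=\mathcal F^-_a$, $\mathcal F^+_ac_{b_{2a}}=-i\mathcal F^-_a$, $\mathcal F^-_ac_{b_{2a-1}}=-\mathcal F^+_a$, $\mathcal F^-_ac_{b_{2a}}=-i\mathcal F^+_a$. (If $b^{\mathcal T}$ is a diagonal entry of $\mathcal R^\lambda$, then $\kappa_b(\mathcal T)=0$, so only generators of $\mathcal{C}l^\lambda_{n-\ell}$ occur with nonzero coefficient in the formula for $t_a\theta_{\mathcal T}$.) *)

(* Defs.v *)
(* Entries of tableaux, Clifford generators and the generators
   t_a, s_a, y_a are numbered from 0: entry b, c_b and t_a here are b+1,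
   c_{b+1} and t_{a+1} in the usual notation. *)
From HB Require Import structures.
From mathcomp Require Import all_boot all_order all_algebra all_fingroup.
From mathcomp Require Import reals ring.
From mathcomp Require Export complex.

Set Implicit Arguments.
Unset Strict Implicit.
Unset Printing Implicit Defensive.

Import GRing.Theory Num.Theory.

Local Open Scope ring_scope.

Section SymDiff.
Variable T : finType.
Implicit Types A B D : {set T}.

Definition symdiff A B : {set T} := (A :\: B) :|: (B :\: A).

Lemma in_symdiff A B i : (i \in symdiff A B) = (i \in A) (+) (i \in B).
Proof. by rewrite !inE; case: (i \in A); case: (i \in B). Qed.

Lemma symdiffA : associative symdiff.
Proof. by move=> A B D; apply/setP=> i; rewrite !in_symdiff addbA. Qed.
Lemma symdiffC : commutative symdiff.
Proof. by move=> A B; apply/setP=> i; rewrite !in_symdiff addbC. Qed.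
Lemma symdiff0s : left_id set0 symdiff.
Proof. by move=> A; apply/setP=> i; rewrite in_symdiff inE. Qed.
Lemma symdiffs0 : right_id set0 symdiff.
Proof. by move=> A; rewrite symdiffC symdiff0s. Qed.
Lemma symdiffss A : symdiff A A = set0.
Proof. by apply/setP=> i; rewrite in_symdiff addbb inE. Qed.
Lemma symdiffK A : involutive (symdiff A).
Proof. by move=> B; rewrite symdiffA symdiffss symdiff0s. Qed.

Lemma prod_symdiff (C : comNzRingType) (f : T -> C) A B :
  (forall i, f i * f i = 1) ->
  \prod_(i in symdiff A B) f i = (\prod_(i in A) f i) * (\prod_(i in B) f i).
Proof.
move=> ff; rewrite !(big_mkcond (fun i => i \in _)) -big_split /=.
apply: eq_bigr => i _; rewrite in_symdiff.
by case: (i \in A); case: (i \in B); rewrite /= ?mulr1 ?mul1r.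
Qed.

End SymDiff.

(* Coordinates in the basis of the monomials c_A = c_{a_1} ... c_{a_k},
   A = {a_1 < ... < a_k}. *)
Definition Cl (C : fieldType) (n : nat) := {ffun {set 'I_n} -> C^o}.

Section Clifford.
Variables (C : fieldType) (n : nat).
Local Notation Cl := (Cl C n).
Implicit Types (A B D : {set 'I_n}) (x y z : Cl).

HB.instance Definition _ := Vector.on Cl.

(* c_A c_B = clsign A B c_{symdiff A B}: one sign for each pair a > b to be
   exchanged and one for each square c_a^2 = -1. *)
Definition clsign A B : C := \prod_(a in A) \prod_(b in B | (b <= a)%N) (-1).

Definition clbasis A : Cl := [ffun B => (B == A)%:R : C^o].

Definition clmul x y : Cl :=
  [ffun D => (\sum_A clsign A (symdiff A D) * (x A * y (symdiff A D)) : C^o)].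

Lemma clsign_sqr A B : clsign A B * clsign A B = 1.
Proof.
rewrite /clsign -big_split big1 //= => a _; rewrite -big_split big1 //= => b _.
by rewrite mulrNN mulr1.
Qed.

Lemma clsignDl A A' B :
  clsign (symdiff A A') B = clsign A B * clsign A' B.
Proof.
apply: prod_symdiff => a; rewrite -big_split big1 //= => b _.
by rewrite mulrNN mulr1.
Qed.

Lemma clsignDr A B B' :
  clsign A (symdiff B B') = clsign A B * clsign A B'.
Proof.
rewrite /clsign -big_split; apply: eq_bigr => a _; rewrite !big_mkcondr.
by apply: prod_symdiff => b; case: ifP; rewrite ?mulrNN mulr1.
Qed.

Lemma clsign0s B : clsign set0 B = 1.
Proof. by rewrite /clsign big_set0. Qed.
Lemma clsigns0 A : clsign A set0 = 1.
Proof. by rewrite /clsign big1 // => a _; rewrite big_pred0 // => b; rewrite inE. Qed.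

Lemma clmulA : associative clmul.
Proof.
move=> x y z; apply/ffunP=> D; rewrite !ffunE.
under eq_bigr => A _ do rewrite ffunE !mulr_sumr.
under [RHS]eq_bigr => E _ do rewrite ffunE mulr_suml mulr_sumr.
rewrite [RHS]exchange_big; apply: eq_bigr => A _ /=.
rewrite [RHS](reindex_inj (inv_inj (symdiffK A))); apply: eq_bigr => B _ /=.
rewrite symdiffK [symdiff A B]symdiffC -symdiffA.
set E := symdiff B (symdiff A D).
have -> : symdiff A D = symdiff B E by rewrite symdiffK.
by rewrite clsignDr clsignDl; ring.
Qed.

Lemma clmul1x : left_id (clbasis set0) clmul.
Proof.
move=> x; apply/ffunP=> D; rewrite !ffunE (bigD1 set0) //= big1 ?addr0.
  by rewrite ffunE eqxx symdiff0s clsign0s !mul1r.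
by move=> A /negPf nA; rewrite ffunE nA mul0r mulr0.
Qed.

Lemma clmulx1 : right_id (clbasis set0) clmul.
Proof.
move=> x; apply/ffunP=> D; rewrite !ffunE (bigD1 D) //= big1 ?addr0.
  by rewrite symdiffss ffunE eqxx clsigns0 mul1r mulr1.
move=> A nA; rewrite ffunE; case: eqP => [AD|_]; last by rewrite !mulr0.
by case/eqP: nA; rewrite -[D](symdiffK A) AD symdiffs0.
Qed.

Lemma clmulDl : left_distributive clmul +%R.
Proof.
move=> x y z; apply/ffunP=> D; rewrite !ffunE -big_split; apply: eq_bigr => A _.
by rewrite ffunE mulrDl mulrDr.
Qed.

Lemma clmulDr : right_distributive clmul +%R.
Proof.
move=> x y z; apply/ffunP=> D; rewrite !ffunE -big_split; apply: eq_bigr => A _.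
by rewrite ffunE !mulrDr.
Qed.

Lemma clone_neq0 : clbasis set0 != 0.
Proof. by apply/eqP=> /ffunP/(_ set0)/eqP; rewrite !ffunE eqxx oner_eq0. Qed.

HB.instance Definition _ := GRing.Zmodule_isNzRing.Build Cl
  clmulA clmul1x clmulx1 clmulDl clmulDr clone_neq0.

Lemma clscalerAl (k : C) x y : k *: (x * y) = (k *: x) * y.
Proof.
apply/ffunP=> D; rewrite !ffunE scaler_sumr; apply: eq_bigr => A _.
rewrite ffunE /GRing.scale /=; ring.
Qed.

HB.instance Definition _ :=
  GRing.Lmodule_isLalgebra.Build C Cl clscalerAl.

Lemma clscalerAr (k : C) x y : k *: (x * y) = x * (k *: y).
Proof.
apply/ffunP=> D; rewrite !ffunE scaler_sumr; apply: eq_bigr => A _.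
rewrite ffunE /GRing.scale /=; ring.
Qed.

HB.instance Definition _ :=
  GRing.Lalgebra_isAlgebra.Build C Cl clscalerAr.

Lemma clbasisM A B :
  clbasis A * clbasis B = clsign A B *: clbasis (symdiff A B).
Proof.
apply/ffunP=> D; rewrite !ffunE (bigD1 A) //= big1 ?addr0; last first.
  by move=> E /negPf nE; rewrite ffunE nE mul0r mulr0.
rewrite !ffunE eqxx mul1r /GRing.scale /=.
have -> : (D == symdiff A B) = (symdiff A D == B).
  by rewrite -(inj_eq (inv_inj (symdiffK A))) symdiffK.
by case: eqP => [->|_]; rewrite ?mulr0.
Qed.

(* The generator c_k; it is only used for k < n. *)
Definition cgen (k : nat) : Cl := clbasis [set i : 'I_n | i == k :> nat].

Lemma cgenE (i : 'I_n) : cgen i = clbasis [set i].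
Proof. by congr clbasis; apply/setP=> j; rewrite !inE. Qed.

Lemma cgen_sqr (i : 'I_n) : cgen i * cgen i = -1.
Proof.
rewrite cgenE clbasisM symdiffss /clsign big_set1.
rewrite (big_pred1 i) ?scaleN1r // => j; rewrite !inE.
by case: eqP => // ->; rewrite leqnn.
Qed.

Lemma cgen_anti (i j : 'I_n) : i != j -> cgen i * cgen j = - (cgen j * cgen i).
Proof.
move=> nij; rewrite !cgenE !clbasisM symdiffC -scaleNr; congr (_ *: _).
have E (k l : 'I_n) : clsign [set k] [set l] = if (l <= k)%N then -1 else 1.
  rewrite /clsign big_set1; case: ifP => lk.
    by rewrite (big_pred1 l) // => h; rewrite !inE; case: eqP => // ->.
  by rewrite big_pred0 // => h; rewrite !inE; case: eqP => // ->.
rewrite !E; case: (ltngtP i j) => [_|_|/val_inj ij]; rewrite ?opprK //.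
by rewrite ij eqxx in nij.
Qed.

(* c_b |-> - c_b *)
Definition clhat x : Cl := [ffun A : {set 'I_n} => (-1) ^+ #|A| *: x A].

Lemma clhat_linear : linear clhat.
Proof.
move=> k x y; apply/ffunP=> A.
by rewrite !ffunE scalerDr !scalerA [_ * k]mulrC.
Qed.

End Clifford.

(* A Z_2-graded module over a superalgebra presented by odd generators
   (indexed by G) and relations is a superspace with one odd operator for each
   generator, subject to the relations.  The record holds the data only. *)
Record superRep (C : fieldType) (G : Type) := SuperRep {
  rep_space :> vectType C;
  rep_even : {vspace rep_space};
  rep_odd : {vspace rep_space};
  rep_op : G -> 'End(rep_space)
}.

Section SuperModules.
Variables (C : fieldType) (G : Type).
Implicit Types M N U : superRep C G.

Definition is_super M : Prop :=
  [/\ (rep_even M + rep_odd M)%VS = fullv,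
      (rep_even M :&: rep_odd M)%VS = 0%VS,
      forall g, (rep_op M g @: rep_even M <= rep_odd M)%VS &
      forall g, (rep_op M g @: rep_odd M <= rep_even M)%VS].

Definition graded_submodule M (W : {vspace M}) : Prop :=
  W = (W :&: rep_even M + W :&: rep_odd M)%VS /\
  forall g, (rep_op M g @: W <= W)%VS.

Definition irreducible_submodule M (W : {vspace M}) : Prop :=
  [/\ graded_submodule W, W <> 0%VS &
      forall W' : {vspace M}, graded_submodule W' -> (W' <= W)%VS ->
        W' = 0%VS \/ W' = W].

Definition irreducible M : Prop := irreducible_submodule (fullv : {vspace M}).

(* Embeddings up to parity shift.  An odd map is required to commute with the
   odd generators; composing it with the parity involution turns it into a map
   that supercommutes with them. *)
Definition embedding M N (f : 'Hom(M, N)) : Prop :=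
  [/\ lker f = 0%VS,
      forall g x, f (rep_op M g x) = rep_op N g (f x) &
      ((f @: rep_even M <= rep_even N)%VS /\ (f @: rep_odd M <= rep_odd N)%VS)
      \/
      ((f @: rep_even M <= rep_odd N)%VS /\ (f @: rep_odd M <= rep_even N)%VS)].

Definition occurs_in M N : Prop := exists f : 'Hom(M, N), embedding f.

Definition isomorphic_to_submodule M N (W : {vspace N}) : Prop :=
  exists2 f : 'Hom(M, N), embedding f & limg f = W.

Definition direct_sum_of_copies M U : Prop :=
  exists k : nat, exists f : 'I_k -> 'Hom(U, M),
    [/\ forall j, embedding (f j),
        directv (\sum_j limg (f j)) &
        (\sum_j limg (f j))%VS = fullv].

End SuperModules.

Section Sergeev.
Variables (C : fieldType) (n : nat).

Definition spin_relations (V : vectType C) (t : 'I_n.-1 -> 'End(V)) : Prop :=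
  [/\ forall a, (t a \o t a)%VF = \1%VF,
      forall a b : 'I_n.-1, b = a.+1 :> nat ->
        (t a \o t b \o t a)%VF = (t b \o t a \o t b)%VF &
      forall a b : 'I_n.-1, (a.+1 < b)%N ->
        (t a \o t b)%VF = - (t b \o t a)%VF].

Definition clifford_relations (V : vectType C) (c : 'I_n -> 'End(V)) : Prop :=
  (forall a, (c a \o c a)%VF = - \1%VF) /\
  (forall a b, a != b -> (c a \o c b)%VF = - (c b \o c a)%VF).

Definition spin_module (M : superRep C 'I_n.-1) : Prop :=
  is_super M /\ spin_relations (rep_op M).

(* inl a is t_a and inr b is c_b. *)
Definition sergeev_module (M : superRep C ('I_n.-1 + 'I_n)) : Prop :=
  [/\ is_super M,
      spin_relations (fun a => rep_op M (inl a)),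
      clifford_relations (fun b => rep_op M (inr b)) &
      forall a b, (rep_op M (inl a) \o rep_op M (inr b))%VF
                  = - (rep_op M (inr b) \o rep_op M (inl a))%VF].

Definition res_spin (M : superRep C ('I_n.-1 + 'I_n)) : superRep C 'I_n.-1 :=
  SuperRep (rep_even M) (rep_odd M) (fun a => rep_op M (inl a)).

End Sergeev.

(* The entries a and a+1 exchanged by s_a. *)
Definition entry0 n (a : 'I_n.-1) : 'I_n := widen_ord (leq_pred n) a.

Lemma entry1_subproof n (a : 'I_n.-1) : (a.+1 < n)%N.
Proof. by case: n a => [|n] [a Ha]. Qed.

Definition entry1 n (a : 'I_n.-1) : 'I_n := Ordinal (entry1_subproof a).

Definition adj n (a : 'I_n.-1) : 'S_n := tperm (entry0 a) (entry1 a).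

(* Products in 'S_n compose from left to right: (s * t) x = t (s x).  Hence
   this is the composite s_{a_1} o ... o s_{a_r}. *)
Definition word_perm n (w : seq 'I_n.-1) : 'S_n := (\prod_(a <- rev w) adj a)%g.

Lemma word_perm_exists n (d : 'S_n) :
  exists r, [exists w : r.-tuple 'I_n.-1, word_perm w == d].
Proof.
suff [w <-] : exists w : seq 'I_n.-1, word_perm w = d.
  by exists (size w); apply/existsP; exists (in_tuple w).
have wM (w1 w2 : seq 'I_n.-1) :
    (word_perm w1 * word_perm w2)%g = word_perm (w2 ++ w1).
  by rewrite /word_perm rev_cat big_cat.
have wT m (i j : 'I_n) : (j = i + m.+1 :> nat)%N ->
    exists w : seq 'I_n.-1, word_perm w = tperm i j.
  elim: m i j => [|m IHm] i j ij.
    have Hi : (i < n.-1)%N.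
      by have:= ltn_ord j; rewrite ij addn1 ltn_predRL.
    exists [:: Ordinal Hi]; rewrite /word_perm big_seq1 /adj.
    by congr tperm; apply: val_inj; rewrite //= ij addn1.
  have Hk : (i + m.+1 < n)%N.
    by apply: leq_trans (ltn_ord j); rewrite ij ltnS leq_add2l.
  have [w1 E1] := IHm i (Ordinal Hk) erefl.
  have Hk1 : (i + m.+1 < n.-1)%N.
    by have:= ltn_ord j; rewrite ij addnS ltn_predRL.
  pose w2 := [:: Ordinal Hk1].
  have E2 : word_perm w2 = tperm (Ordinal Hk) j.
    rewrite /word_perm big_seq1 /adj.
    by congr tperm; apply: val_inj; rewrite //= ij !addnS.
  exists (w2 ++ (w1 ++ w2)); rewrite -!wM E1 E2.
  have -> : tperm i j = (tperm i (Ordinal Hk) ^ tperm (Ordinal Hk) j)%g.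
    by rewrite tpermJ tpermL tpermD // -val_eqE /= ?ij neq_ltn addnS ltnS
       leq_addr orbT.
  by rewrite conjgE tpermV mulgA.
have [ts -> _] := prod_tpermP d.
elim: ts => [|[i j] ts [w IHw]] /=.
  by exists [::]; rewrite /word_perm !big_nil.
rewrite big_cons /= -IHw.
have [w1 <-] : exists w1 : seq 'I_n.-1, word_perm w1 = tperm i j.
  case: (ltngtP i j) => [lij|lij|/val_inj ->].
  - by apply: (wT (j - i).-1); rewrite prednK ?subn_gt0 // subnKC // ltnW.
  - rewrite tpermC.
    by apply: (wT (i - j).-1); rewrite prednK ?subn_gt0 // subnKC // ltnW.
  - by exists [::]; rewrite tperm1 /word_perm big_nil.
by exists (w ++ w1); rewrite wM.
Qed.

(* The Coxeter length: least number of factors in a product of the s_a. *)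
Definition perm_length n (d : 'S_n) : nat := ex_minn (word_perm_exists d).

Definition strict_partition (n : nat) (lam : seq nat) : bool :=
  [&& sorted gtn lam, 0%N \notin lam & sumn lam == n].

(* Row by row; this order defines the row-words below. *)
Definition boxes (lam : seq nat) : seq (nat * nat) :=
  [seq (i, (i + j)%N) | i <- iota 0 (size lam), j <- iota 0 (nth 0%N lam i)].

Definition box (lam : seq nat) (k : nat) : nat * nat :=
  nth (0%N, 0%N) (boxes lam) k.

(* A bijective filling of the diagram is encoded by its row-word, seen as a
   permutation d: the k-th box of [boxes lam] has entry d k.  The row-tableau
   is the identity and the filling is obtained from it by letting d act on the
   entries, so that the filling d has d(T) = d, and b^T = d^-1 b. *)
Definition standard (n : nat) (lam : seq nat) (d : 'S_n) : bool :=
  [forall k : 'I_n, forall m : 'I_n,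
    ((box lam k).1 == (box lam m).1) && ((box lam k).2 < (box lam m).2)%N
    || ((box lam k).2 == (box lam m).2) && ((box lam k).1 < (box lam m).1)%N
    ==> (d k < d m)%N].

Definition stdtab (n : nat) (lam : seq nat) : Type :=
  {d : 'S_n | standard lam d}.
HB.instance Definition _ n lam := Finite.on (stdtab n lam).
HB.instance Definition _ n lam := SubType.on (stdtab n lam).

Section Tableaux.
Variables (n : nat) (lam : seq nat).
Implicit Type d : 'S_n.

(* b^T *)
Definition reg_entry d (b : 'I_n) : 'I_n := (d^-1)%g b.

(* s_a acting on the entries *)
Definition swap (a : 'I_n.-1) d : 'S_n := (d * adj a)%g.

Definition inv_count d (b : 'I_n) : nat :=
  #|[set b' : 'I_n | (b' < b)%N && (reg_entry d b < reg_entry d b')%N]|.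

(* s_{b-1} s_{b-2} ... s_{b-i_b} for increasing b *)
Definition tab_word d : seq nat :=
  flatten [seq rev (iota (b - inv_count d b)%N (inv_count d b))
          | b : 'I_n <- enum 'I_n].

Definition eps_exponent (a : 'I_n.-1) d : nat :=
  let ia := inv_count d (entry0 a) in
  let ia1 := inv_count d (entry1 a) in
  let rest := (\sum_(b : 'I_n | entry1 a < b) inv_count d b)%N in
  if (perm_length d < perm_length (swap a d))%N
  then (ia * ia1.+1 + rest)%N else (ia.+1 * ia1.+1 + rest)%N.

(* The non-diagonal entries b_1 < b_2 < ... of the row-tableau. *)
Definition nondiag : seq 'I_n :=
  [seq k : 'I_n <- enum 'I_n | (box lam k).1 != (box lam k).2].

End Tableaux.

Section Uhat.
Variables (C : numClosedFieldType) (n : nat) (lam : seq nat).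
Local Notation Cl := (Cl C n).
Local Notation c := (cgen C n).
Implicit Types (d : 'S_n) (a : 'I_n.-1).

Definition kappa d (b : 'I_n) : C :=
  let x := box lam (reg_entry d b) in
  let sigma := (x.2 - x.1)%N in sqrtC (sigma * sigma.+1)%:R.

Definition Acoef (u v : C) : C := 1 - ((u - v) ^+ 2)^-1 - ((u + v) ^+ 2)^-1.

Definition Ycoef a d : C :=
  sqrtC (Acoef (kappa d (entry0 a)) (kappa d (entry1 a))).

Definition ygen (k : nat) : Cl := (sqrtC 2)^-1 *: (c k.+1 - c k).

Definition Uspace : vectType C := {ffun stdtab n lam -> Cl}.

Definition clact (x : Cl) (u : Uspace) : Uspace := [ffun T => x * u T].

(* v_T, set to 0 if the filling d is not standard *)
Definition vvec d : Uspace := [ffun T : stdtab n lam => (val T == d)%:R].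

Definition s_on_v a d : Uspace :=
  let k := kappa d (entry0 a) in
  let k1 := kappa d (entry1 a) in
  clact ((k1 - k)^-1 *: 1 + (k1 + k)^-1 *: (c a * c a.+1)) (vvec d)
  + Ycoef a d *: vvec (swap a d).

(* Since t_a = y_a s_a and t_a anticommutes with every c_b,
   t_a (x v_T) = clhat x y_a (s_a v_T) for x in the Clifford algebra. *)
Definition t_fun a (u : Uspace) : Uspace :=
  \sum_(T : stdtab n lam) clact (clhat (u T) * ygen a) (s_on_v a (val T)).

(* The vectors v_T are even. *)
Definition Uhat : superRep C ('I_n.-1 + 'I_n) :=
  @SuperRep C ('I_n.-1 + 'I_n) Uspace
    (\sum_(T : stdtab n lam) \sum_(A : {set 'I_n} | ~~ odd #|A|)
       <[clact (clbasis C A) (vvec (val T))]>)%VS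
    (\sum_(T : stdtab n lam) \sum_(A : {set 'I_n} | odd #|A|)
       <[clact (clbasis C A) (vvec (val T))]>)%VS
    (fun g => match g with
              | inl a => linfun (t_fun a)
              | inr b => linfun (clact (c b))
              end).

Lemma clact_linear x : linear (clact x).
Proof.
by move=> k u v; apply/ffunP=> T; rewrite !ffunE mulrDr scalerAr.
Qed.

Lemma clactM x y u : clact x (clact y u) = clact (x * y) u.
Proof. by apply/ffunP=> T; rewrite !ffunE mulrA. Qed.

Lemma clactDl x y u : clact (x + y) u = clact x u + clact y u.
Proof. by apply/ffunP=> T; rewrite !ffunE mulrDl. Qed.

Lemma clactZl k x u : clact (k *: x) u = k *: clact x u.
Proof. by apply/ffunP=> T; rewrite !ffunE scalerAl. Qed.

Lemma clact0l u : clact 0 u = 0.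
Proof. by apply/ffunP=> T; rewrite !ffunE mul0r. Qed.

Lemma clact1l u : clact 1 u = u.
Proof. by apply/ffunP=> T; rewrite !ffunE mul1r. Qed.

Lemma t_fun_linear a : linear (t_fun a).
Proof.
move=> k u v; rewrite /t_fun scaler_sumr -big_split; apply: eq_bigr => T _ /=.
by rewrite !ffunE clhat_linear mulrDl clactDl -scalerAl clactZl.
Qed.

Lemma c_opE (b : 'I_n) u : rep_op Uhat (inr b) u = clact (c b) u.
Proof.
pose L := GRing.isLinear.Build C Uspace Uspace *:%R _ (clact_linear (c b)).
pose f : {linear Uspace -> Uspace} := HB.pack (clact (c b)) L.
exact: (lfunE f).
Qed.

Lemma t_opE a u : rep_op Uhat (inl a) u = t_fun a u.
Proof.
pose L := GRing.isLinear.Build C Uspace Uspace *:%R _ (t_fun_linear a).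
pose f : {linear Uspace -> Uspace} := HB.pack (t_fun a) L.
exact: (lfunE f).
Qed.

(* s_a = t_a (c_{a+1} - c_a) / sqrt 2 acts on v_T by the seminormal formula. *)
Lemma s_opE a (T : stdtab n lam) :
  (sqrtC 2)^-1 *: t_fun a (clact (c a.+1 - c a) (vvec (val T)))
  = s_on_v a (val T).
Proof.
have s2 : (sqrtC 2 : C) * sqrtC 2 = 2 by rewrite -expr2 sqrtCK.
have s2n : (sqrtC 2 : C) != 0 by rewrite sqrtC_eq0 pnatr_eq0.
have a0 : c a = c (entry0 a) by [].
have a1 : c a.+1 = c (entry1 a) by [].
have hc (b : 'I_n) : clhat (c b) = - c b.
  apply/ffunP=> A; rewrite cgenE !ffunE; case: eqP => [->|_]; last first.
    by rewrite scaler0 oppr0.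
  by rewrite cards1 expr1 scaleN1r.
have hD x y : clhat (x + y) = clhat x + clhat y :> Cl.
  by have:= clhat_linear 1 x y; rewrite !scale1r.
have hN x : clhat (- x) = - clhat x :> Cl.
  have h0 : clhat 0 = 0 :> Cl by apply/ffunP=> A; rewrite !ffunE scaler0.
  by have:= clhat_linear (-1) x 0; rewrite !scaleN1r !addr0 h0 addr0.
rewrite /t_fun (bigD1 T) //= big1 ?addr0; last first.
  move=> T' nT; rewrite !ffunE (inj_eq val_inj) (negPf nT) mulr0.
  have -> : clhat 0 = 0 :> Cl by apply/ffunP=> A; rewrite !ffunE scaler0.
  by rewrite mul0r clact0l.
rewrite !ffunE eqxx mulr1 hD hN a0 a1 !hc -clactZl.
suff -> : (sqrtC 2)^-1 *: ((- c (entry1 a) - - c (entry0 a)) * ygen a) = 1 :> Cl.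
  by rewrite clact1l.
have n01 : entry0 a != entry1 a by rewrite -val_eqE /= neq_ltn ltnSn.
rewrite /ygen a1 [c a]a0 -scalerAr scalerA -invfM s2 opprK.
have -> : (- c (entry1 a) + c (entry0 a)) * (c (entry1 a) - c (entry0 a)) = 2.
  rewrite mulrDl !mulrBr !mulNr !cgen_sqr (cgen_anti C n01) !opprK addrC.
  by rewrite [1 + _]addrC addrACA addNr add0r.
by rewrite -scalerMnr scalerMnl -mulr_natr mulVf ?scale1r ?pnatr_eq0.
Qed.

Definition theta d : Uspace :=
  clact (\prod_(k <- rev (tab_word d)) ygen k) (vvec d).

(* c_{b_1}, c_{b_2}, ..., so that c_{b_{j+1}} is [cb`_j] *)
Definition cb : seq Cl := [seq c (val b) | b <- nondiag n lam].

Definition Fplus (a : nat) : Cl := 1 + 'i *: (cb`_(a.*2) * cb`_(a.*2.+1)).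
Definition Fminus (a : nat) : Cl := cb`_(a.*2) + 'i *: cb`_(a.*2.+1).

(* n - l = 2p or 2p + 1 with p = (n - l)./2; the second component is alpha,
   which can only be 0 if n - l is even.  [true] stands for the sign -. *)
Definition delta_index : finType :=
  ({ffun 'I_((n - size lam)./2) -> bool} * 'I_(odd (n - size lam)).+1)%type.

Definition Fdelta (dl : delta_index) : Cl :=
  (\prod_(a < (n - size lam)./2) if dl.1 a then Fminus a else Fplus a)
  * cb`_((n - size lam)./2.*2) ^+ dl.2.

Definition delta_parity (dl : delta_index) : nat := #|[set a | dl.1 a]| + dl.2.

Definition Espan : {vspace Cl} := <<codom Fdelta>>%VS.

Definition basis_vector (x : delta_index * stdtab n lam) : Uhat :=
  clact (Fdelta x.1) (theta (val x.2)).

Definition basis_span : {vspace Uhat} := <<codom basis_vector>>%VS.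

Definition t_coef a d : Cl :=
  let k := kappa d (entry0 a) in
  let k1 := kappa d (entry1 a) in
  (sqrtC 2 / (k ^+ 2 - k1 ^+ 2)) *:
    (k *: c (reg_entry d (entry0 a)) - k1 *: c (reg_entry d (entry1 a))).

(* The predicates "U is (a model of) U^lambda" and "V is (a model of) V^lambda".
   Both modules are only defined up to isomorphism and parity shift. *)
Definition is_Ulambda (U : superRep C ('I_n.-1 + 'I_n)) : Prop :=
  [/\ sergeev_module U, irreducible U & direct_sum_of_copies Uhat U].

Definition is_Vlambda (V : superRep C 'I_n.-1) : Prop :=
  [/\ spin_module V, irreducible V &
      exists2 U, is_Ulambda U & occurs_in V (res_spin U)].

End Uhat.

(* Main.v *)
Require Import Defs.
From HB Require Import structures.
From mathcomp Require Import all_boot all_order all_algebra all_fingroup.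
From mathcomp Require Import reals complex zify ring.

(** Two facts on the vectors [y_a] give the formula for [t_a theta_T]. First,
    [y_a c_b = - c_(s_a b) y_a] and [y_a ^ 2 = -1], so the product [Theta d] of the
    vectors [y] along the reversed canonical word of [d] carries [c_b] to
    [c_(d^-1 b)] up to the sign of [d] ([Theta_cgen]). Secondly, [Theta d y_a] is
    [Theta (s_a d)] up to a sign, computed by conjugating one run of the canonical
    word by another ([Theta_swap]). Since [t_a v_T = y_a s_a v_T], they turn the
    seminormal formula for [s_a v_T] into the one for [t_a theta_T]
    ([spin_op_theta]). The coefficients that occur there act on [E] by right
    multiplication, and they only involve off-diagonal generators because [kappa_b]
    vanishes on the diagonal; hence [W = E theta] is stable.

    Irreducibility uses the Jucys-Murphy elements rather than a dimension count. The
    operators [X_b : x v_T |-> clhat x kappa_b(T) c_b v_T] satisfy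
    [t_a X_a + X_(a+1) t_a = sqrt 2] ([spin_op_jm]), while [X_1 = 0] and
    [t_a ^ 2 = 1]; so they belong to the algebra generated by the [t_a], and every
    graded submodule is stable under them. The squares [X_b ^ 2] act on [E theta_T]
    by the scalars [kappa_b(T) ^ 2], which determine the contents of the entries and
    hence [T] ([content_inj]). On [E theta_T] itself [X_b] is, up to sign and a
    scalar, right multiplication by [c_(b^T)]. The [F^delta] are joint eigenvectors,
    with distinct eigenvalues, of the products of paired generators and of the parity
    ([Fdelta_pair]), and the generators permute them up to nonzero scalars
    ([Fdelta_cb]). So a nonzero graded submodule of [W] contains some
    [F^delta theta_T], then all of them for this [T], and then all of them for every
    [T], since [t_a] leads from [T] to [s_a T] with the nonzero coefficient [Y_a] and
    descents can be removed until the row tableau is reached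
    ([basis_span_irreducible]). The same separation of eigenvectors proves that the
    [F^delta theta_T] are linearly independent.

    Finally, left multiplication by a Clifford monomial, twisted by the parity
    involution if the monomial is odd, commutes with the [t_a]. The [F^delta]
    generate the Clifford algebra as a left ideal, so the translates of [W] span
    [Uhat] ([translates_full]), and every simple module that embeds into [Uhat] is
    isomorphic to [W] ([simple_in_translates]). This applies to [V^lambda], which
    embeds into [U^lambda] and thereby into [Uhat]. *)

Set Implicit Arguments.
Unset Strict Implicit.
Unset Printing Implicit Defensive.

Import Order.TTheory GRing.Theory Num.Theory.

Local Open Scope ring_scope.

(** * Inversions and the Coxeter length *)

Section Inversions.
Variable n : nat.
Implicit Types (d : 'S_n) (a : 'I_n.-1) (b : 'I_n) (w : seq 'I_n.-1).

Definition ascent a d : bool :=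
  (reg_entry d (entry0 a) < reg_entry d (entry1 a))%N.

Definition inversions d : nat := (\sum_(b : 'I_n) inv_count d b)%N.

Lemma entry01_neq a : entry0 a != entry1 a.
Proof. by rewrite -val_eqE /= neq_ltn ltnSn. Qed.

Lemma entry_ltn a : (a < n)%N /\ (a.+1 < n)%N.
Proof. by split; [exact: (ltn_ord (entry0 a))|exact: (ltn_ord (entry1 a))]. Qed.

Lemma reg_entry_swap a d b : reg_entry (swap a d) b = reg_entry d (adj a b).
Proof. by rewrite /reg_entry /swap invMg permM tpermV. Qed.

Lemma reg_entryK d b : d (reg_entry d b) = b.
Proof. exact: permKV. Qed.

Lemma reg_entry_inj d : injective (reg_entry d).
Proof. exact: perm_inj. Qed.

Lemma swapK a : involutive (swap a).
Proof. by move=> d; rewrite /swap -mulgA tperm2 mulg1. Qed.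

Lemma swap_entry0 a d : reg_entry (swap a d) (entry0 a) = reg_entry d (entry1 a).
Proof. by rewrite reg_entry_swap tpermL. Qed.

Lemma swap_entry1 a d : reg_entry (swap a d) (entry1 a) = reg_entry d (entry0 a).
Proof. by rewrite reg_entry_swap tpermR. Qed.

Lemma swap_other a d b : b != entry0 a -> b != entry1 a ->
  reg_entry (swap a d) b = reg_entry d b.
Proof. by move=> n0 n1; rewrite reg_entry_swap tpermD 1?eq_sym. Qed.

Lemma ascent_swap a d : ascent a (swap a d) = ~~ ascent a d.
Proof.
rewrite /ascent swap_entry0 swap_entry1 -leqNgt ltn_neqAle.
by rewrite (inj_eq (@ord_inj n)) (inj_eq (@reg_entry_inj d)) eq_sym entry01_neq.
Qed.

Lemma inv_count_swap_other a d b : b != entry0 a -> b != entry1 a ->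
  inv_count (swap a d) b = inv_count d b.
Proof.
move=> n0 n1; rewrite /inv_count -(card_imset _ (@perm_inj _ (adj a))).
apply: eq_card => x; rewrite -[x in LHS](tpermK (entry0 a) (entry1 a)).
rewrite (mem_imset _ _ (@perm_inj _ (adj a))) !inE swap_other // reg_entry_swap.
rewrite tpermK; congr (_ && _).
move: n0 n1; rewrite -!val_eqE /= => n0 n1.
case: tpermP => [->|->|//] /=; lia.
Qed.

Lemma inv_count_swap1 a d : ascent a d ->
  inv_count (swap a d) (entry1 a) = (inv_count d (entry0 a)).+1.
Proof.
move=> asc; rewrite /inv_count.
set S := [set b' : 'I_n | (b' < entry0 a)%N &&
  (reg_entry d (entry0 a) < reg_entry d b')%N].
have -> : #|S|.+1 = #|entry0 a |: S| by rewrite cardsU1 !inE ltnn.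
apply: eq_card => x; rewrite !inE swap_entry1.
case: (eqVneq x (entry0 a)) => [->|nx]; first by rewrite swap_entry0 /= ltnSn.
case: (eqVneq x (entry1 a)) => [->|nx1].
  by rewrite ltnn /= ltnNge leqnSn.
rewrite swap_other //= ltnS [(x <= a)%N]leq_eqVlt.
by rewrite (negPf nx : (x == a :> nat) = _).
Qed.

Lemma inv_count_swap0 a d : ascent a d ->
  inv_count (swap a d) (entry0 a) = inv_count d (entry1 a).
Proof.
move=> asc; apply: eq_card => x; rewrite !inE swap_entry0.
case: (eqVneq x (entry0 a)) => [->|nx].
  rewrite ltnn /=; apply/esym/negbTE; rewrite negb_and -!leqNgt.
  by rewrite (ltnW asc) orbT.
case: (eqVneq x (entry1 a)) => [->|nx1].
  by rewrite /= ltnn ltnNge leqnSn.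
rewrite swap_other //= ltnS [(x <= a)%N]leq_eqVlt.
by rewrite (negPf nx : (x == a :> nat) = _).
Qed.

Lemma inv_count_ascent a d : ascent a d ->
  (inv_count d (entry1 a) <= inv_count d (entry0 a))%N.
Proof.
move=> asc; apply/subset_leq_card/subsetP => x; rewrite !inE /= => /andP[xa lt].
rewrite (ltn_trans asc lt) andbT; move: xa; rewrite ltnS leq_eqVlt => /orP[|//].
move/eqP => xa; have {}xa : x = entry0 a by apply: val_inj.
by move: lt; rewrite xa ltnNge (ltnW asc).
Qed.

Lemma inv_count_le d b : (inv_count d b <= b)%N.
Proof.
rewrite /inv_count.
have E : #|[set x : 'I_n | x < b]%N| = b.
  rewrite cardsE cardE -(size_map val).
  rewrite -[RHS](size_iota 0); apply/esym; apply/perm_size/uniq_perm; rewrite ?iota_uniq //.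
    by rewrite map_inj_uniq ?enum_uniq //; apply: val_inj.
  move=> k; rewrite mem_iota /=; apply/idP/mapP => [kb|[x]].
    by exists (Ordinal (ltn_trans kb (ltn_ord b))) => //; rewrite mem_enum.
  by rewrite mem_enum => xb ->.
by rewrite -[leqRHS]E; apply/subset_leq_card/subsetP => x; rewrite !inE => /andP[].
Qed.

Lemma inversions_split a d : inversions d =
  (inv_count d (entry0 a) + (inv_count d (entry1 a)
   + \sum_(b | (b != entry0 a) && (b != entry1 a)) inv_count d b))%N.
Proof.
by rewrite /inversions (bigD1 (entry0 a)) // (bigD1 (entry1 a)) // eq_sym entry01_neq.
Qed.

Lemma inversions_ascent a d : ascent a d ->
  inversions (swap a d) = (inversions d).+1.
Proof.
move=> asc; rewrite !(inversions_split a) inv_count_swap0 // inv_count_swap1 //.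
rewrite addSn addnS addnCA; congr ((_ + (_ + _)).+1).
by apply: eq_bigr => b /andP[]; apply: inv_count_swap_other.
Qed.

Lemma inversions_descent a d : ~~ ascent a d ->
  inversions d = (inversions (swap a d)).+1.
Proof. by rewrite -ascent_swap => /inversions_ascent; rewrite swapK. Qed.

(** The differences [reg_entry d b - b] are then nonnegative, and they add up to
    zero. *)
Lemma all_ascents_id d : (forall a, ascent a d) -> d = 1%g.
Proof.
move=> asc; suff le b : (b <= reg_entry d b)%N.
  have eqS : \sum_(b : 'I_n) (reg_entry d b : nat) = \sum_(b : 'I_n) (b : nat).
    rewrite (reindex_inj (@reg_entry_inj (d^-1)%g)) /=.
    by apply: eq_bigr => b _; rewrite /reg_entry invgK permK.
  have eq0 : (\sum_(b : 'I_n) (reg_entry d b - b) = 0)%N.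
    have: (\sum_(b : 'I_n) (reg_entry d b - b) + \sum_(b : 'I_n) b
           = \sum_(b : 'I_n) reg_entry d b)%N.
      by rewrite -big_split; apply: eq_bigr => b _ /=; rewrite subnK.
    have -> : (\sum_(b : 'I_n) reg_entry d b = \sum_(b : 'I_n) b)%N by exact: eqS.
    lia.
  apply/permP => b; rewrite perm1 -[RHS](reg_entryK d); congr (d _).
  move/eqP: eq0; rewrite sum_nat_eq0 => /forallP/(_ b)/implyP/(_ isT).
  by rewrite subn_eq0 => le2; apply/val_inj/eqP; rewrite eqn_leq le.
case: b => b; elim: b => [|b IH] lb //.
have lb' : (b < n.-1)%N by lia.
have /= := asc (Ordinal lb'); rewrite /ascent.
have -> : entry0 (Ordinal lb') = Ordinal (ltnW lb) by apply: val_inj.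
have -> : entry1 (Ordinal lb') = Ordinal lb by apply: val_inj.
exact: leq_ltn_trans (IH _).
Qed.

(** Every nontrivial permutation has a descent, and swapping it removes an
    inversion. *)
Lemma descent_ind (P : 'S_n -> Prop) : P 1%g ->
  (forall a d, ascent a d -> P d -> P (swap a d)) -> forall d, P d.
Proof.
move=> P1 PS d; have [m] := ubnP (inversions d).
elim: m d => // m IH d; rewrite ltnS => lem.
case: (pickP (fun a => ~~ ascent a d)) => [a desc|asc].
  rewrite -(swapK a d); apply: PS; first by rewrite ascent_swap.
  by apply: IH; rewrite -(inversions_descent desc).
by rewrite (all_ascents_id (fun a => negbFE (asc a))).
Qed.

Lemma inv_count1 b : inv_count 1%g b = 0%N.
Proof.
apply: eq_card0 => x; rewrite !inE /reg_entry invg1 !perm1.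
by case: ltngtP.
Qed.

Lemma inversions1 : inversions 1%g = 0%N.
Proof. by rewrite /inversions big1 // => b _; apply: inv_count1. Qed.

Lemma word_perm_cons a w : word_perm (a :: w) = swap a (word_perm w).
Proof. by rewrite /word_perm rev_cons -cats1 big_cat big_seq1. Qed.

Lemma inversions_word w : (inversions (word_perm w) <= size w)%N.
Proof.
elim: w => [|a w IH]; first by rewrite /word_perm big_nil inversions1.
rewrite word_perm_cons /=; case: (boolP (ascent a (word_perm w))) => [asc|desc].
  by rewrite inversions_ascent.
by rewrite (leq_trans _ (leqW IH)) // (inversions_descent desc).
Qed.

(** A swap of consecutive entries changes the number of inversions by exactly one,
    which bounds the length of a word from below; removing descents one by one
    reaches the bound. *)
Lemma perm_lengthE d : perm_length d = inversions d.
Proof.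
rewrite /perm_length; case: ex_minnP => m /existsP[w /eqP wd] min.
apply/eqP; rewrite eqn_leq; apply/andP; split; last first.
  by rewrite -wd -[leqRHS](size_tuple w) inversions_word.
apply: min; elim/descent_ind: d {m w wd} => [|a d asc /existsP[w /eqP wd]].
  apply/existsP; rewrite inversions1; exists [tuple].
  by rewrite /word_perm big_nil.
apply/existsP; rewrite inversions_ascent //; exists [tuple of a :: w].
by rewrite word_perm_cons wd.
Qed.

Lemma perm_length_ascent a d :
  (perm_length d < perm_length (swap a d))%N = ascent a d.
Proof.
rewrite !perm_lengthE; case: (boolP (ascent a d)) => [asc|desc].
  by rewrite inversions_ascent ?ltnSn.
by rewrite [inversions d](inversions_descent desc) ltnNge leqnSn.
Qed.

End Inversions.

(** * Words in the vectors y_k of the Clifford algebra *)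

Section CliffordWords.
Variables (C : numClosedFieldType) (n : nat).
Local Notation Cl := (Cl C n).
Local Notation c := (cgen C n).
Local Notation y := (ygen C n).
Implicit Types (x z : Cl) (k m b : nat) (w : seq nat).

Lemma cgen_sqr_nat b : (b < n)%N -> c b * c b = -1.
Proof. by move=> lb; apply: (cgen_sqr C (Ordinal lb)). Qed.

Lemma cgen_anti_nat b k : (b < n)%N -> (k < n)%N -> b != k ->
  c b * c k = - (c k * c b).
Proof. by move=> lb lk nbk; apply: (@cgen_anti C n (Ordinal lb) (Ordinal lk)). Qed.

Lemma signZK (V : lmodType C) k (u : V) : (-1) ^+ k *: ((-1) ^+ k *: u) = u.
Proof. by rewrite scalerA -expr2 sqrr_sign scale1r. Qed.

Lemma sqrtC2_neq0 : sqrtC 2 != 0 :> C.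
Proof. by rewrite sqrtC_eq0 pnatr_eq0. Qed.

Definition transp k b : nat :=
  if b == k then k.+1 else if b == k.+1 then k else b.

Lemma val_adj (a : 'I_n.-1) (b : 'I_n) : adj a b = transp a b :> nat.
Proof.
rewrite /transp; case: tpermP => [->|->|/eqP + /eqP +] /=.
- by rewrite eqxx.
- by rewrite eqxx gtn_eqF.
by rewrite -!val_eqE /= => /negPf-> /negPf->.
Qed.

(** Conjugation by the unit vector [y_k] of the Clifford algebra is minus the
    reflection that exchanges [c_k] and [c_(k+1)]. *)
Lemma ygen_cgen k b : (k.+1 < n)%N -> (b < n)%N ->
  y k * c b = - (c (transp k b) * y k).
Proof.
move=> lk lb; have lk' := ltnW lk.
rewrite /ygen -scalerAl -scalerAr -scalerN; congr (_ *: _).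
rewrite mulrBl mulrBr opprB /transp.
have [->|nk] := eqVneq b k; first by rewrite !cgen_sqr_nat.
have [->|nk1] := eqVneq b k.+1; first by rewrite !cgen_sqr_nat.
by rewrite (cgen_anti_nat lb lk nk1) (cgen_anti_nat lb lk' nk) opprK addrC.
Qed.


Lemma ygen_far k b : (k.+1 < n)%N -> (b.+1 < n)%N -> (k.+1 < b)%N ->
  y k * y b = - (y b * y k).
Proof.
move=> lk lb kb; rewrite [y b]/ygen -scalerAr -[RHS]mulNr -[in RHS]scalerN.
rewrite -[RHS]scalerAl; congr (_ *: _).
rewrite mulrBr !ygen_cgen // 1?ltnW // /transp.
rewrite !gtn_eqF ?(ltnW kb) // 1?ltnW // 1?ltnW //.
by rewrite mulNr mulrBl opprB opprK addrC.
Qed.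

Lemma ygen_sqr k : (k.+1 < n)%N -> y k * y k = -1.
Proof.
move=> lk; rewrite {2}/ygen -scalerAr mulrBr !ygen_cgen // 1?ltnW // /transp.
rewrite !eqxx gtn_eqF // opprK addrC -mulrBl /ygen -scalerAr scalerA.
rewrite -invfM -expr2 sqrtCK mulrBl !mulrBr !cgen_sqr_nat // 1?ltnW //.
rewrite (@cgen_anti_nat k.+1 k) // 1?ltnW // ?gtn_eqF //.
rewrite !opprK opprD addrA addrK -opprD.
by rewrite scalerN -mulr2n -scaler_nat scalerA mulVf ?scale1r // pnatr_eq0.
Qed.

Definition yprod w : Cl := \prod_(k <- w) y k.

Lemma yprod_nil : yprod [::] = 1.
Proof. exact: big_nil. Qed.

Lemma yprod_cons k w : yprod (k :: w) = y k * yprod w.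
Proof. exact: big_cons. Qed.

Lemma yprod_cat w1 w2 : yprod (w1 ++ w2) = yprod w1 * yprod w2.
Proof. exact: big_cat. Qed.

Definition letter k := (k.+1 < n)%N.

Lemma transp_lt k b : letter k -> (b < n)%N -> (transp k b < n)%N.
Proof.
by rewrite /letter /transp => lk lb; case: eqP => // _; case: eqP => // _; apply: ltnW.
Qed.

Lemma word_act_lt w b : all letter w -> (b < n)%N -> (foldr transp b w < n)%N.
Proof. by elim: w => //= k w IH /andP[lk lw] lb; apply: transp_lt => //; apply: IH. Qed.

Lemma yprod_cgen w b : all letter w -> (b < n)%N ->
  yprod w * c b = (-1) ^+ size w *: (c (foldr transp b w) * yprod w).
Proof.
elim: w => [|k w IH] /=; first by rewrite yprod_nil mul1r mulr1 scale1r.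
move=> /andP[lk lw] lb; rewrite yprod_cons -mulrA IH // -scalerAr !mulrA.
by rewrite ygen_cgen ?word_act_lt // mulNr scalerN exprS mulN1r scaleNr.
Qed.

Lemma word_act_out m l b : (b < m)%N -> foldr transp b (iota m l) = b.
Proof.
elim: l m => //= l IH m bm; rewrite IH ?(ltn_trans bm) //.
by rewrite /transp !ltn_eqF // ltnW.
Qed.

Lemma word_act_run m l b : (m <= b < m + l)%N -> foldr transp b (iota m l) = b.+1.
Proof.
elim: l m => /= [|l IH] m; first by rewrite addn0; case: leqP.
rewrite leq_eqVlt => /andP[/orP[/eqP<-|mb] ml].
  by rewrite word_act_out // /transp eqxx.
by rewrite IH ?mb ?addSnnS // /transp !gtn_eqF // ltnS ltnW.
Qed.

(** Conjugation by a run [y_m ... y_(m+l-1)] is, up to sign, the cyclic shift of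
    [m, ..., m+l], so it carries the generators inside the run one step up. *)
Lemma yprod_run_shift m l k : (m + l < n)%N -> (m <= k)%N -> (k.+1 < m + l)%N ->
  y k.+1 * yprod (iota m l) = (-1) ^+ l *: (yprod (iota m l) * y k).
Proof.
move=> ln mk kl.
have lw : all letter (iota m l).
  by apply/allP => j; rewrite mem_iota => /andP[_ jl]; apply: leq_ltn_trans jl ln.
have E b : (m <= b < m + l)%N ->
    c b.+1 * yprod (iota m l) = (-1) ^+ l *: (yprod (iota m l) * c b).
  move=> /[dup] bm /andP[_ bl]; rewrite yprod_cgen ?(ltn_trans bl) // size_iota.
  by rewrite word_act_run // scalerA -expr2 sqrr_sign scale1r.
rewrite /ygen -scalerAl -scalerAr scalerA mulrC -scalerA; congr (_ *: _).
by rewrite mulrBl mulrBr !E ?scalerBr // ?mk ?(leq_trans mk) // ltnW.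
Qed.

Lemma yprod_run_run m l h j : (m + l < n)%N -> (m <= h)%N -> (h + j < m + l)%N ->
  yprod (iota h.+1 j) * yprod (iota m l)
  = (-1) ^+ (j * l) *: (yprod (iota m l) * yprod (iota h j)).
Proof.
move=> ln; elim: j h => [|j IH] h mh hl.
  by rewrite !yprod_nil mul1r mulr1 scale1r.
rewrite /= !yprod_cons -mulrA IH ?leqW ?addSnnS // -scalerAr !mulrA.
rewrite yprod_run_shift //; last by lia.
by rewrite -scalerAl scalerA -exprD -mulSnr.
Qed.

Lemma yprod_far w k : all (fun j => j.+1 < k)%N w -> letter k ->
  yprod w * y k = (-1) ^+ size w *: (y k * yprod w).
Proof.
move=> + lk; elim: w => [_|j w IH] /=.
  by rewrite yprod_nil mul1r mulr1 scale1r.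
move=> /andP[jk wk]; rewrite yprod_cons -mulrA IH // -scalerAr !mulrA (@ygen_far j) //.
  by rewrite mulNr scalerN exprS mulN1r scaleNr.
exact: ltn_trans jk (ltnW lk).
Qed.

End CliffordWords.

(** * The products along the canonical words and their signs *)

Section TabWords.
Variables (C : numClosedFieldType) (n : nat).
Local Notation Cl := (Cl C n).
Local Notation c := (cgen C n).
Local Notation y := (ygen C n).
Local Notation yprod := (@yprod C n).
Implicit Types (i : nat -> nat) (d : 'S_n) (a : 'I_n.-1).

(** The reverse of the word [tab_word], with arbitrary lengths [i b] of the runs, so
    that the words of two permutations can be compared run by run. *)
Definition runs i m : seq nat :=
  flatten [seq iota (b - i b) (i b) | b <- rev (iota 0 m)].

Lemma runsS i m : runs i m.+1 = iota (m - i m) (i m) ++ runs i m.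
Proof. by rewrite /runs -addn1 iotaD rev_cat. Qed.

Lemma size_runs i m : size (runs i m) = (\sum_(b < m) i b)%N.
Proof.
elim: m => [|m IH]; first by rewrite big_ord0.
by rewrite runsS size_cat size_iota IH big_ord_recr addnC.
Qed.

Lemma all_runs (p : pred nat) i m :
  (forall b k, (b < m)%N -> (b - i b <= k < b)%N -> p k) ->
  (forall b, (b < m)%N -> (i b <= b)%N) -> all p (runs i m).
Proof.
elim: m => [|m IH] // pm im; rewrite runsS all_cat IH => [||b bm]; last 2 first.
- by move=> b k bm; apply: pm; apply: leqW.
- by apply: im; apply: leqW.
rewrite andbT; apply/allP => k; rewrite mem_iota subnK ?im //.
exact: pm.
Qed.

Lemma eq_runs i i' m : (forall b, (b < m)%N -> i b = i' b) -> runs i m = runs i' m.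
Proof.
elim: m => [|m IH] // E; rewrite !runsS E // IH // => b bm.
by rewrite E // leqW.
Qed.

(** The sign comes from moving [y_a] past the runs of the smaller entries, and from
    conjugating the run of [a+1] by the run of [a] lengthened by [y_a]. *)
Lemma yprod_runs_swap i i' (a m : nat) :
  (a.+1 < m <= n)%N -> (forall b, (b <= a)%N -> (i b <= b)%N) ->
  (i a.+1 <= i a)%N -> i' a = i a.+1 -> i' a.+1 = (i a).+1 ->
  (forall b : nat, b != a -> b != a.+1 -> i' b = i b) ->
  yprod (runs i m) * y a
  = (-1) ^+ (\sum_(b < a) i b + i a.+1 * (i a).+1) *: yprod (runs i' m).
Proof.
case/andP=> am mn ib ia i'a i'a1 i'b.
have la : letter n a by rewrite /letter (leq_trans am).
elim: m mn am => // m IH mn; rewrite ltnS leq_eqVlt => /orP[/eqP<-|am]; last first.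
  rewrite !runsS !yprod_cat -mulrA (IH (ltnW mn) am) -scalerAr.
  by rewrite i'b ?gtn_eqF // ltnW.
rewrite !runsS !yprod_cat -!mulrA yprod_far //; last first.
  apply: all_runs => [b k ba /andP[_ kb]|b ba]; last by rewrite ib 1?ltnW.
  exact: leq_ltn_trans kb ba.
have -> : runs i' a = runs i a.
  by apply: eq_runs => b ba; rewrite i'b // ltn_eqF // leqW.
rewrite size_runs -!scalerAr [yprod _ * (y a * _)]mulrA exprD -scalerA.
congr (_ *: _); rewrite i'a i'a1 subSS.
have -> : yprod (iota (a - i a) (i a)) * y a = yprod (iota (a - i a) (i a).+1).
  rewrite -[(i a).+1]addn1 iotaD yprod_cat subnK ?ib //.
  by congr (_ * _); rewrite yprod_cons yprod_nil mulr1.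
rewrite !mulrA subSn; last by apply: leq_trans ia (ib _ _).
have ila := ib a (leqnn a).
rewrite yprod_run_run ?scalerAl //; rewrite ?addnS ?subnK // ?leq_sub2l //.
exact: leq_trans ia ila.
Qed.

Definition invn d b : nat :=
  if insub b is Some b' then inv_count d (b' : 'I_n) else 0%N.

Lemma invnE d (b : 'I_n) : invn d b = inv_count d b.
Proof. by rewrite /invn valK. Qed.

Lemma rev_tab_word d : rev (tab_word d) = runs (invn d) n.
Proof.
rewrite /tab_word rev_flatten /runs -val_enum_ord -!map_rev -!map_comp.
by congr flatten; apply: eq_map => b /=; rewrite revK invnE.
Qed.

Definition Theta d : Cl := yprod (rev (tab_word d)).

Lemma size_tab_word d : size (rev (tab_word d)) = inversions d.
Proof.
by rewrite rev_tab_word size_runs; apply: eq_bigr => b _; rewrite invnE.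
Qed.

Lemma invn_le d b : (invn d b <= b)%N.
Proof. by rewrite /invn; case: insubP => //= b' _ <-; apply: inv_count_le. Qed.

Lemma tab_word_letters d : all (letter n) (rev (tab_word d)).
Proof.
rewrite rev_tab_word; apply: all_runs => [b k bn /andP[_ kb]|b _].
  exact: leq_ltn_trans kb bn.
exact: invn_le.
Qed.

Lemma inversions_rest a d : inversions d =
  (\sum_(b < a) invn d b + inv_count d (entry0 a) + inv_count d (entry1 a)
   + \sum_(b : 'I_n | entry1 a < b) inv_count d b)%N.
Proof.
have an : (a <= n)%N := ltnW (ltn_ord (entry0 a)).
rewrite (inversions_split a) (big_ord_widen n (invn d) an).
rewrite (bigID (fun b : 'I_n => (b < a)%N)) /=.
rewrite [X in (_ + (_ + (X + _)))%N](_ : _ = \sum_(b < n | (b < a)%N) invn d b)%N.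
  rewrite [X in (_ + (_ + (_ + X)))%N](eq_bigl (fun b : 'I_n => (entry1 a < b)%N)).
    by rewrite /=; lia.
  by move=> b; rewrite -!val_eqE /=; lia.
apply: eq_big => b; last by rewrite invnE.
by rewrite -!val_eqE /=; lia.
Qed.

Lemma Theta_ascent a d : ascent a d ->
  (-1) ^+ inversions d *: (Theta d * y a)
  = (-1) ^+ (inv_count d (entry0 a) * (inv_count d (entry1 a)).+1
             + \sum_(b : 'I_n | (entry1 a < b)%N) inv_count d b)
    *: Theta (swap a d).
Proof.
move=> asc; rewrite /Theta !rev_tab_word.
rewrite (@yprod_runs_swap _ (invn (swap a d))) ?(ltn_ord (entry1 a)) //=.
- rewrite scalerA -exprD; congr (_ *: _).
  rewrite (inversions_rest a) (invnE d (entry1 a)) (invnE d (entry0 a)).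
  set S := (\sum_(b < a) _)%N; set Q := (\sum_(b | _) _)%N.
  set i0 := inv_count d (entry0 a); set i1 := inv_count d (entry1 a).
  have -> : (S + i0 + i1 + Q + (S + i1 * i0.+1) = 2 * (S + i1) + (i0 * i1.+1 + Q))%N.
    by lia.
  by rewrite exprD exprM sqrrN expr1n expr1n mul1r.
- by move=> b _; apply: invn_le.
- by rewrite (invnE d (entry1 a)) (invnE d (entry0 a)) inv_count_ascent.
- by rewrite (invnE d (entry1 a)) (invnE _ (entry0 a)) inv_count_swap0.
- by rewrite (invnE _ (entry1 a)) (invnE d (entry0 a)) inv_count_swap1.
move=> b n0 n1; rewrite /invn; case: insubP => // b' _ vb.
by rewrite inv_count_swap_other // -val_eqE /= vb.
Qed.

(** For a descent the identity is the one of the ascent [swap a d], multiplied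
    by [y_a] and simplified by [y_a ^ 2 = -1]. *)
Lemma Theta_swap a d :
  (-1) ^+ inversions d *: (Theta d * y a)
  = (-1) ^+ eps_exponent a d *: Theta (swap a d).
Proof.
rewrite /eps_exponent perm_length_ascent.
have [asc|desc] := boolP (ascent a d); first exact: Theta_ascent.
have asc : ascent a (swap a d) by rewrite ascent_swap.
have := Theta_ascent asc; rewrite swapK.
set E' := (_ * _ + _)%N; set E := (_ * _ + _)%N.
have EE : (-1) ^+ E = (-1) ^+ E' :> C.
  have a0 := inv_count_swap0 asc; have a1 := inv_count_swap1 asc.
  rewrite swapK in a0 a1; rewrite /E /E' a0 a1.
  have -> : (\sum_(b : 'I_n | (entry1 a < b)%N) inv_count d b
             = \sum_(b : 'I_n | (entry1 a < b)%N) inv_count (swap a d) b)%N.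
    by apply: eq_bigr => b ab; rewrite inv_count_swap_other // -val_eqE /= gtn_eqF //; apply: ltnW.
  set x := inv_count _ (entry0 a); set z := inv_count _ (entry1 a); set S := (\sum_(_ | _) _)%N.
  have -> : (z.+1 * x.+2 + S = 2 * z.+1 + (x * z.+1 + S))%N by lia.
  by rewrite exprD exprM sqrrN !expr1n mul1r.
move=> h.
have -> : Theta (swap a d)
    = - ((-1) ^+ inversions (swap a d) *: ((-1) ^+ E' *: (Theta d * y a))).
  rewrite [_ *: (Theta d * y a)]scalerAl -h scalerAl signZK -mulrA.
  by rewrite ygen_sqr ?(ltn_ord (entry1 a)) // mulrN1 opprK.
rewrite (inversions_descent desc) exprS mulN1r scaleNr scalerN EE.
by rewrite [X in _ = - X]scalerA mulrC -[X in _ = - X]scalerA signZK.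
Qed.

Lemma Theta1 : Theta 1 = 1.
Proof.
have := size_tab_word 1; rewrite /Theta inversions1.
by case: rev => // _; rewrite yprod_nil.
Qed.

(** Conjugation by [y_a] contributes the transposition [adj a], and [Theta_swap]
    removes the letters of [d] one descent at a time. *)
Lemma Theta_cgen d (b : 'I_n) :
  Theta d * c b = (-1) ^+ inversions d *: (c (reg_entry d b) * Theta d).
Proof.
elim/descent_ind: d b => [|a d asc IH] b.
  by rewrite Theta1 inversions1 mul1r mulr1 scale1r /reg_entry invg1 perm1.
have [s ->] : exists s : C, Theta (swap a d) = s *: (Theta d * y a).
  exists ((-1) ^+ eps_exponent a d * (-1) ^+ inversions d).
  by rewrite -scalerA Theta_swap scalerA -expr2 sqrr_sign scale1r.
rewrite -[LHS]scalerAl -[in RHS]scalerAr [RHS]scalerA [_ * s]mulrC -[RHS]scalerA.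
congr (_ *: _).
rewrite -mulrA ygen_cgen ?(ltn_ord (entry1 a)) // -val_adj mulrN mulrA IH.
rewrite reg_entry_swap inversions_ascent // exprS mulN1r scaleNr.
by rewrite mulrA -scalerAl.
Qed.

(** Every [y_k] squares to [-1]. *)
Lemma Theta_inv d : exists2 z : Cl, Theta d * z = 1 & z * Theta d = 1.
Proof.
rewrite /Theta; elim: rev (tab_word_letters d) => [_|k w IH] /=.
  by exists 1; rewrite yprod_nil mul1r.
case/andP=> lk /IH[z wz zw]; exists (z * - y k); rewrite yprod_cons.
  by rewrite -mulrA [yprod w * _]mulrA wz mul1r mulrN ygen_sqr ?opprK.
by rewrite -mulrA [- y k * _]mulrA mulNr ygen_sqr // opprK mul1r zw.
Qed.

End TabWords.

(** * Boxes and contents of shifted tableaux *)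

Section Boxes.
Variables (n : nat) (lam : seq nat).
Hypothesis hlam : strict_partition n lam.
Implicit Types (p q : nat * nat) (k m : 'I_n) (d : 'S_n) (a : 'I_n.-1).
Local Notation bx := (box lam).

Definition lex p q : bool := (p.1 < q.1)%N || (p.1 == q.1) && (p.2 < q.2)%N.

Definition in_diagram p : bool :=
  (p.1 < size lam)%N && (p.1 <= p.2 < p.1 + nth 0%N lam p.1)%N.

Lemma mem_boxes p : (p \in boxes lam) = in_diagram p.
Proof.
apply/allpairsPdep/andP => [[i [j [+ + ->]]] /=|[pl /andP[pp lp]]].
  by rewrite !mem_iota /= !add0n => il jl; rewrite il leq_addr ltn_add2l.
exists p.1, (p.2 - p.1)%N; rewrite !mem_iota !add0n subnKC //.
split=> //; [lia|by case: (p)].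
Qed.

Lemma boxes_lex : pairwise lex (boxes lam).
Proof.
suff h (m l : nat) : pairwise lex
    [seq (i, i + j)%N | i <- iota m l, j <- iota 0 (nth 0%N lam i)] by exact: h.
elim: l m => //= l IH m.
rewrite pairwise_cat IH andbT; apply/andP; split; last first.
  rewrite pairwise_map; apply: (@sub_pairwise _ ltn) => [j j'|].
    by rewrite /lex /= eqxx ltnn ltn_add2l.
  by rewrite -(sorted_pairwise ltn_trans) iota_ltn_sorted.
apply/allrelP => p q /mapP[j _ ->] /allpairsPdep[i [j' [+ _ ->]]].
by rewrite mem_iota /lex /= => /andP[-> _].
Qed.

Lemma size_boxes : size (boxes lam) = n.
Proof.
case/and3P: hlam => _ _ /eqP <-; rewrite /boxes size_allpairs_dep.
by congr sumn; rewrite -[RHS](mkseq_nth 0%N); apply: eq_map => i; rewrite size_iota.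
Qed.

Lemma box_lex k m : (k < m)%N -> lex (bx k) (bx m).
Proof.
by move/(pairwiseP (0%N, 0%N)): boxes_lex => h; apply: h; rewrite inE size_boxes.
Qed.

Lemma box_inj k m : bx k = bx m -> k = m.
Proof.
move=> E; apply: ord_inj; case: (ltngtP k m) => // /box_lex.
  by rewrite E /lex !ltnn andbF.
by rewrite E /lex !ltnn andbF.
Qed.

Lemma box_in k : in_diagram (bx k).
Proof. by rewrite -mem_boxes mem_nth // size_boxes. Qed.

Lemma box_onto p : in_diagram p -> exists k, bx k = p.
Proof.
rewrite -mem_boxes => /(nthP (0%N, 0%N))[k]; rewrite size_boxes => kn <-.
by exists (Ordinal kn).
Qed.

(** As the parts are distinct, the right ends of the rows of the shifted diagram
    do not increase. *)
Lemma row_end_le i j : (i <= j)%N -> (j < size lam)%N ->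
  (j + nth 0 lam j <= i + nth 0 lam i)%N.
Proof.
case/and3P: hlam => srt _ _ ij.
elim: j ij => [|j IH]; first by rewrite leqn0 => /eqP->.
rewrite leq_eqVlt => /orP[/eqP->//|ij] jl.
apply: leq_trans (IH ij (ltnW jl)).
by have := (sortedP 0%N srt) j jl; rewrite /gtn /= addSnnS leq_add2l.
Qed.

Definition boxrel k m : bool :=
  ((bx k).1 == (bx m).1) && ((bx k).2 < (bx m).2)%N
  || ((bx k).2 == (bx m).2) && ((bx k).1 < (bx m).1)%N.

Lemma standardP d :
  reflect (forall k m, boxrel k m -> (d k < d m)%N) (standard lam d).
Proof.
apply: (iffP forallP) => [h k m km|h k].
  by have /forallP/(_ m)/implyP := h k; apply.
by apply/forallP => m; apply/implyP; apply: h.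
Qed.

Lemma boxrel_lt k m : boxrel k m -> (k < m)%N.
Proof.
move=> km; case: (ltngtP k m) => // [/box_lex|/ord_inj E].
  by move: km; rewrite /lex /boxrel; lia.
by move: km; rewrite E /boxrel; lia.
Qed.

(** The box at the row of [k] and the column of [m] is in the diagram, and its entry
    lies strictly between the two others. *)
Lemma std_gap d k m : standard lam d -> ((bx k).1 < (bx m).1)%N ->
  ((bx k).2 < (bx m).2)%N -> ((d k).+1 < d m)%N.
Proof.
move=> /standardP std r12 c12.
have [r rE] : exists r : 'I_n, bx r = ((bx k).1, (bx m).2).
  apply: box_onto; have := box_in k; have := box_in m.
  rewrite /in_diagram /= => /and3P[ml _ m2] /and3P[-> k2 _].
  by have := row_end_le (ltnW r12) ml; lia.
have /std k_r : boxrel k r by rewrite /boxrel rE /= eqxx c12.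
have /std r_m : boxrel r m by rewrite /boxrel rE /= eqxx r12 orbT.
exact: leq_ltn_trans k_r r_m.
Qed.

Lemma std_le d k m : standard lam d -> ((bx k).1 <= (bx m).1)%N ->
  ((bx k).2 <= (bx m).2)%N -> (d k <= d m)%N.
Proof.
move=> std; rewrite [((bx k).1 <= _)%N]leq_eqVlt [((bx k).2 <= _)%N]leq_eqVlt.
case/orP=> [/eqP r12|r12] /orP[/eqP c12|c12].
- by rewrite (@box_inj k m) // [bx k]surjective_pairing r12 c12 -surjective_pairing.
- by apply/ltnW/(standardP _ std); rewrite /boxrel r12 c12 eqxx.
- by apply/ltnW/(standardP _ std); rewrite /boxrel r12 c12 eqxx orbT.
by have := std_gap std r12 c12; lia.
Qed.

Definition content k : nat := ((bx k).2 - (bx k).1)%N.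

Lemma box_contentE k : (bx k).2 = ((bx k).1 + content k)%N.
Proof. by rewrite subnKC //; case/and3P: (box_in k). Qed.

Lemma content_eq0 k : (content k == 0%N) = ((bx k).1 == (bx k).2).
Proof. by rewrite subn_eq0 eqn_leq; case/and3P: (box_in k) => _ ->. Qed.

(** A box between those of [a] and [a+1] would carry an entry between them, so these
    boxes are adjacent if they are comparable; if they are not, one of them is
    strictly above and strictly to the right of the other. *)
Lemma consecutive_boxes d a (k := reg_entry d (entry0 a))
    (m := reg_entry d (entry1 a)) : standard lam d ->
  if boxrel k m then content m = (content k).+1 \/ content k = (content m).+1
  else ((content k).+1 < content m)%N \/ ((content m).+1 < content k)%N.
Proof.
move=> std; have dk : d k = a :> nat by rewrite /k reg_entryK.
have dm : d m = a.+1 :> nat by rewrite /m reg_entryK.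
have btw r : boxrel k r -> boxrel r m -> False.
  by move=> /(standardP _ std) + /(standardP _ std); lia.
have := box_contentE k; have := box_contentE m; have := box_in k; have := box_in m.
move=> /and3P[ml m1 m2] /and3P[kl k1 k2] mE kE.
case: ifP => [/orP[/andP[/eqP r12 c12]|/andP[/eqP c12 r12]]|].
- left; apply/eqP; case: ltngtP => [|lt|//]; first by lia.
  have [r rE] : exists r : 'I_n, bx r = ((bx k).1, (bx k).2.+1).
    by apply: box_onto; rewrite -r12 in m2; rewrite /in_diagram /=; lia.
  by case: (btw r); rewrite /boxrel rE /=; lia.
- right; apply/eqP; case: ltngtP => [|lt|//]; first by lia.
  have [r rE] : exists r : 'I_n, bx r = ((bx k).1.+1, (bx k).2).
    apply: box_onto; rewrite /in_diagram /=.
    by have := row_end_le r12 ml; lia.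
  by case: (btw r); rewrite /boxrel rE /=; lia.
move=> nkm; have : ~ ((bx m).1 <= (bx k).1 /\ (bx m).2 <= (bx k).2)%N.
  by case=> r12 c12; have := std_le std r12 c12; lia.
have : ~ ((bx k).1 < (bx m).1 /\ (bx k).2 < (bx m).2)%N.
  by case=> r12 c12; have := std_gap std r12 c12; lia.
by move: nkm; rewrite /boxrel; lia.
Qed.

(** The swap reverses no comparison of entries except that of [a] and [a+1]. *)
Lemma standard_swap d a : standard lam d ->
  standard lam (swap a d) = ~~ boxrel (reg_entry d (entry0 a)) (reg_entry d (entry1 a)).
Proof.
move=> std; apply/standardP/idP => [stds|nr k m km].
  apply/negP => /stds; rewrite /swap !permM !reg_entryK tpermL tpermR /=.
  by rewrite ltnNge leqnSn.
have := standardP _ std k m km; rewrite /swap !permM !val_adj.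
have : ~~ ((d k == a :> nat) && (d m == a.+1 :> nat)).
  apply: contra nr => /andP[/eqP dk /eqP dm].
  have -> : entry0 a = d k by apply: val_inj; rewrite /= dk.
  have -> : entry1 a = d m by apply: val_inj; rewrite /= dm.
  by rewrite /reg_entry !permK.
by rewrite /transp; do 4?[case: eqP => ? /=]; lia.
Qed.

Lemma standard_id : standard lam (1%g : 'S_n).
Proof. by apply/standardP => k m /boxrel_lt; rewrite !perm1. Qed.

(** Comparable boxes are read in increasing order, hence a descent is never between
    comparable boxes. *)
Lemma standard_descent d a : standard lam d -> ~~ ascent a d ->
  standard lam (swap a d).
Proof.
by move=> std; rewrite standard_swap //; apply: contra => /boxrel_lt.
Qed.

(** By induction on [b]: once the smaller entries are placed, [b] can only be at the
    first free box of its diagonal. *)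
Lemma content_inj d d' : standard lam d -> standard lam d' ->
  (forall b, content (reg_entry d b) = content (reg_entry d' b)) -> d = d'.
Proof.
move=> std std' E; suff eqr b : reg_entry d b = reg_entry d' b.
  by apply: (can_inj (@invgK _)); apply/permP => b; apply: eqr.
have [m] := ubnP b; elim: m b => // m IH b; rewrite ltnS => bm.
have lt_row d1 d2 : standard lam d1 -> standard lam d2 ->
    (forall b' : 'I_n, (b' < b)%N -> reg_entry d1 b' = reg_entry d2 b') ->
    content (reg_entry d1 b) = content (reg_entry d2 b) ->
    ((bx (reg_entry d1 b)).1 < (bx (reg_entry d2 b)).1)%N -> False.
  move=> std1 std2 E12 cE r12.
  have := @std_gap d2 _ _ std2 r12; rewrite !box_contentE cE ltn_add2r r12.
  move=> /(_ isT); rewrite reg_entryK => lt.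
  have := E12 (d2 (reg_entry d1 b)) (ltn_trans (ltnSn _) lt).
  by rewrite [reg_entry d2 (d2 _)]permK => /reg_entry_inj E3; move: lt; rewrite E3; lia.
apply: box_inj; rewrite [LHS]surjective_pairing [RHS]surjective_pairing.
rewrite !box_contentE E; suff -> : (bx (reg_entry d b)).1 = (bx (reg_entry d' b)).1 by [].
case: (ltngtP (bx (reg_entry d b)).1 (bx (reg_entry d' b)).1) => //.
  by move/lt_row => []// b' b'b; apply: IH; lia.
by move/lt_row => []// b' b'b; apply/esym/IH; lia.
Qed.

Lemma content_first d (b : 'I_n) : standard lam d -> b = 0%N :> nat ->
  content (reg_entry d b) = 0%N.
Proof.
move=> std b0; set k := reg_entry d b.
have := box_in k; have := box_contentE k; move=> kE /and3P[kl k1 k2].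
have [r rE] : exists r : 'I_n, bx r = ((bx k).1, (bx k).1).
  by apply: box_onto; rewrite /in_diagram /=; lia.
apply/eqP; rewrite eqn0Ngt; apply/negP => c0.
have /(standardP _ std) : boxrel r k by rewrite /boxrel rE /= kE eqxx; lia.
by rewrite /k reg_entryK b0.
Qed.

Lemma mem_nondiag k : (k \in nondiag n lam) = (content k != 0%N).
Proof. by rewrite mem_filter mem_enum andbT content_eq0. Qed.

Lemma uniq_nondiag : uniq (nondiag n lam).
Proof. by rewrite filter_uniq // enum_uniq. Qed.

(** Every row starts with its only diagonal box. *)
Lemma size_nondiag : size (nondiag n lam) = (n - size lam)%N.
Proof.
rewrite size_filter.
have -> : count (fun k : 'I_n => (bx k).1 != (bx k).2) (enum 'I_n)
        = count (fun p => p.1 != p.2) (boxes lam).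
  rewrite -[in RHS](mkseq_nth (0%N, 0%N) (boxes lam)) size_boxes /mkseq.
  by rewrite -val_enum_ord -map_comp count_map.
rewrite -[in RHS]size_boxes -(count_predC (fun p => p.1 != p.2)).
suff -> : count (predC (fun p => p.1 != p.2)) (boxes lam) = size lam by rewrite addnK.
have pos i : (i < size lam)%N -> (0 < nth 0%N lam i)%N.
  move=> il; rewrite lt0n; case/and3P: hlam => _ n0 _.
  by apply: contra n0 => /eqP<-; apply: mem_nth.
rewrite /boxes -[RHS](size_iota 0).
have : forall i, i \in iota 0 (size lam) -> (0 < nth 0%N lam i)%N.
  by move=> i; rewrite mem_iota => /pos.
elim: (iota _ _) => //= i s IH h; rewrite count_cat IH => [|j js]; last first.
  by apply: h; rewrite inE js orbT.
have /h : i \in i :: s by rewrite inE eqxx.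
case: nth => // l _ /=; rewrite addn0 eqxx /= count_map; congr (_.+1).
rewrite (@eq_in_count _ _ pred0) ?count_pred0 // => j.
by rewrite mem_iota /= => /andP[j0 _]; apply/negbTE; rewrite negbK; lia.
Qed.

End Boxes.

(** * Parity in the Clifford algebra and the numbers kappa *)

Section Grading.
Variables (C : numClosedFieldType) (n : nat).
Local Notation Cl := (Cl C n).
Local Notation c := (cgen C n).
Implicit Types (x z : Cl) (A : {set 'I_n}).

Lemma sign_symdiff A B : (-1) ^+ #|symdiff A B| = (-1) ^+ #|A| * (-1) ^+ #|B| :> C.
Proof. by rewrite -!prodr_const prod_symdiff // => i; rewrite mulrNN mulr1. Qed.

Lemma clhatE x A : clhat x A = (-1) ^+ #|A| * x A.
Proof. by rewrite ffunE. Qed.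

Lemma clhatD x z : clhat (x + z) = clhat x + clhat z.
Proof. by have := clhat_linear 1 x z; rewrite !scale1r. Qed.

Lemma clhat0 : clhat (0 : Cl) = 0.
Proof. by apply/ffunP => A; rewrite !ffunE scaler0. Qed.

Lemma clhatZ k x : clhat (k *: x) = k *: clhat x.
Proof. by have := clhat_linear k x 0; rewrite clhat0 !addr0. Qed.

Lemma clhatN x : clhat (- x) = - clhat x.
Proof. by rewrite -scaleN1r clhatZ scaleN1r. Qed.

Lemma clhatM x z : clhat (x * z) = clhat x * clhat z.
Proof.
apply/ffunP => D; rewrite clhatE !ffunE mulr_sumr; apply: eq_bigr => A _.
rewrite !clhatE -{1}[D](symdiffK A) sign_symdiff; ring.
Qed.

Lemma clhatK : involutive (@clhat C n).
Proof. by move=> x; apply/ffunP => A; rewrite !clhatE mulrA -expr2 sqrr_sign mul1r. Qed.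

Lemma clhat_basis A : clhat (clbasis C A) = (-1) ^+ #|A| *: clbasis C A.
Proof.
apply/ffunP => B; rewrite clhatE !ffunE; case: eqP => [->//|_].
by rewrite mulr0 scaler0.
Qed.

Lemma clhat1 : clhat (1 : Cl) = 1.
Proof. by rewrite -[1]/(clbasis C set0) clhat_basis cards0 scale1r. Qed.

Lemma clhat_cgen b : (b < n)%N -> clhat (c b) = - c b.
Proof.
move=> lb; rewrite (cgenE C (Ordinal lb)) clhat_basis cards1 expr1 scaleN1r.
by [].
Qed.

Lemma clbasis_expand x : x = \sum_A x A *: clbasis C A.
Proof.
apply/ffunP => B; rewrite sum_ffunE (bigD1 B) //= !ffunE eqxx big1.
  by rewrite addr0 [RHS]mulr1.
by move=> A nA; rewrite !ffunE eq_sym (negPf nA) [LHS]mulr0.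
Qed.

Lemma clhat_yprod w : all (letter n) w ->
  clhat (yprod C n w) = (-1) ^+ size w *: yprod C n w.
Proof.
elim: w => [|k w IH] /=; first by rewrite yprod_nil clhat1 scale1r.
case/andP=> lk /IH wE; rewrite yprod_cons clhatM wE /ygen clhatZ clhatD clhatN.
rewrite (clhat_cgen lk) (clhat_cgen (ltnW lk)) -opprD scalerN mulNr -scalerAr exprS mulN1r.
by rewrite scaleNr.
Qed.

Lemma clhat_Theta (d : 'S_n) : clhat (Theta C d) = (-1) ^+ inversions d *: Theta C d.
Proof. by rewrite clhat_yprod ?size_tab_word // tab_word_letters. Qed.

End Grading.

Section Kappa.
Variables (C : numClosedFieldType) (n : nat) (lam : seq nat).
Implicit Types (d : 'S_n) (a : 'I_n.-1) (b : 'I_n).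
Local Notation kappa := (kappa C lam).
Local Notation cont d b := (content lam (reg_entry d b)).

Lemma kappa_sq d b : kappa d b ^+ 2 = (cont d b * (cont d b).+1)%:R.
Proof. exact: sqrtCK. Qed.

Lemma kappa_eq0 d b : (kappa d b == 0) = (cont d b == 0%N).
Proof. by rewrite sqrtC_eq0 pnatr_eq0 muln_eq0 orbF. Qed.

Lemma kappa_sq_eq d d' b b' :
  (kappa d b ^+ 2 == kappa d' b' ^+ 2) = (cont d b == cont d' b').
Proof.
rewrite !kappa_sq eqr_nat; apply/eqP/eqP => [|->//]; nia.
Qed.

Lemma kappa_swap0 a d : kappa (swap a d) (entry0 a) = kappa d (entry1 a).
Proof. by rewrite /Defs.kappa swap_entry0. Qed.

Lemma kappa_swap1 a d : kappa (swap a d) (entry1 a) = kappa d (entry0 a).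
Proof. by rewrite /Defs.kappa swap_entry1. Qed.

Lemma AcoefE (u v : C) : u ^+ 2 != v ^+ 2 ->
  Acoef u v = ((u ^+ 2 - v ^+ 2) ^+ 2 - 2 * (u ^+ 2 + v ^+ 2))
              / (u ^+ 2 - v ^+ 2) ^+ 2.
Proof.
move=> uv; have : u ^+ 2 - v ^+ 2 != 0 by rewrite subr_eq0.
rewrite subr_sqr mulf_eq0 negb_or => /andP[m p]; rewrite /Acoef; field.
by rewrite m p.
Qed.

Hypothesis hlam : strict_partition n lam.

Lemma kappa_consecutive d a : standard lam d ->
  kappa d (entry0 a) ^+ 2 != kappa d (entry1 a) ^+ 2.
Proof.
move=> std; rewrite kappa_sq_eq; apply/eqP => E.
have := consecutive_boxes hlam a std; rewrite /= E.
by case: ifP => _ []; lia.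
Qed.

(** With [k ^ 2 = s (s+1)] the numerator of [Acoef] is
    [(s - s') ^ 2 (s + s' + 1) ^ 2 - 2 s (s+1) - 2 s' (s'+1)], which factors as
    [((s - s') ^ 2 - 1) ((s + s' + 1) ^ 2 - 1)]. *)
Lemma Acoef_eq0 d a : standard lam d ->
  (Acoef (kappa d (entry0 a)) (kappa d (entry1 a)) == 0)
  = ~~ standard lam (swap a d).
Proof.
move=> std; rewrite AcoefE ?kappa_consecutive // mulf_eq0 invr_eq0 expf_eq0 /=.
have := kappa_consecutive a std; rewrite -subr_eq0 => /negPf->.
rewrite orbF subr_eq0.
rewrite (standard_swap hlam) // negbK !kappa_sq; have := consecutive_boxes hlam a std.
rewrite /=; set s := cont d (entry0 a); set s' := cont d (entry1 a).
have E : (((s * s.+1)%:R - (s' * s'.+1)%:R) ^+ 2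
          == 2 * ((s * s.+1)%:R + (s' * s'.+1)%:R) :> C)
  = ((s * s.+1 * (s * s.+1) + s' * s'.+1 * (s' * s'.+1)
     == 2 * (s * s.+1 + s' * s'.+1) + 2 * (s * s.+1) * (s' * s'.+1)))%N.
  rewrite -(eqr_nat C) !natrD !natrM -subr_eq0 -[in RHS]subr_eq0.
  by congr (_ == 0); ring.
have far x z : (x.+1 < z)%N -> (x * x.+1 * (x * x.+1) + z * z.+1 * (z * z.+1)
    != 2 * (x * x.+1 + z * z.+1) + 2 * (x * x.+1) * (z * z.+1))%N.
  move=> xz; have [w zE] : exists w, (z * z.+1 = x * x.+1 + (4 * x + 6 + w))%N.
    by exists (z * z.+1 - (x * x.+1 + (4 * x + 6)))%N; nia.
  by rewrite zE; apply/eqP; nia.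
rewrite E; case: ifP => _ st.
  by apply/eqP; case: st => ->; nia.
by case: st => /far/eqP h; apply/negbTE/eqP => F; apply: h; lia.
Qed.

Lemma Ycoef_sq d a :
  Ycoef C lam a d ^+ 2 = Acoef (kappa d (entry0 a)) (kappa d (entry1 a)).
Proof. exact: sqrtCK. Qed.

Lemma Ycoef_eq0 d a : standard lam d ->
  (Ycoef C lam a d == 0) = ~~ standard lam (swap a d).
Proof. by move=> std; rewrite -Acoef_eq0 // -Ycoef_sq expf_eq0. Qed.

Lemma Ycoef_swap d a : Ycoef C lam a (swap a d) = Ycoef C lam a d.
Proof.
by rewrite /Ycoef kappa_swap0 kappa_swap1 /Acoef [_ + kappa d (entry0 a)]addrC
  -sqrrN opprB.
Qed.

End Kappa.

(** * The action of t_a and the Jucys-Murphy elements *)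

Section Action.
Variables (C : numClosedFieldType) (n : nat) (lam : seq nat).
Hypothesis hlam : strict_partition n lam.
Local Notation Cl := (Cl C n).
Local Notation c := (cgen C n).
Local Notation y := (ygen C n).
Local Notation U := (Uspace C n lam).
Local Notation kappa := (kappa C lam).
Local Notation v := (vvec C lam).
Local Notation theta := (theta C lam).
Local Notation Y := (Ycoef C lam).
Implicit Types (x z : Cl) (u : U) (d : 'S_n) (a : 'I_n.-1) (b : 'I_n).

Definition spin_op a : 'End(U) := rep_op (Uhat C n lam) (inl a).

Lemma spin_opE a u : spin_op a u = t_fun a u.
Proof. exact: t_opE. Qed.

Lemma clactDr x u u' : clact x (u + u') = clact x u + clact x u'.
Proof. by have := clact_linear x 1 u u'; rewrite !scale1r. Qed.

Lemma clact0r x : clact x (0 : U) = 0.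
Proof. by apply/ffunP => T; rewrite !ffunE mulr0. Qed.

Lemma clactZr k x u : clact x (k *: u) = k *: clact x u.
Proof. by have := clact_linear x k u 0; rewrite clact0r !addr0. Qed.

Lemma clactNl x u : clact (- x) u = - clact x u.
Proof. by rewrite -scaleN1r clactZl scaleN1r. Qed.

Lemma clact_sumr (I : finType) (P : pred I) (F : I -> U) x :
  clact x (\sum_(i | P i) F i) = \sum_(i | P i) clact x (F i).
Proof. exact: (big_morph _ (clactDr x) (clact0r x)). Qed.

Lemma clact_suml (I : finType) (P : pred I) (F : I -> Cl) u :
  clact (\sum_(i | P i) F i) u = \sum_(i | P i) clact (F i) u.
Proof. exact: (big_morph (fun x => clact x u) (fun x z => clactDl x z u) (clact0l u)). Qed.

Lemma Uspace_expand u : u = \sum_(T : stdtab n lam) clact (u T) (v (val T)).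
Proof.
apply/ffunP => T; rewrite sum_ffunE (bigD1 T) //= !ffunE eqxx mulr1.
rewrite big1 ?addr0 // => T' nT; rewrite !ffunE (inj_eq val_inj) eq_sym.
by rewrite (negPf nT) mulr0.
Qed.

Lemma vvec_nonstandard d : ~~ standard lam d -> v d = 0.
Proof.
move=> nd; apply/ffunP => T; rewrite !ffunE; case: eqP => // E.
by case/negP: nd; rewrite -E (valP T).
Qed.

(** The module is free over the Clifford algebra on the vectors [v_T]. *)
Lemma clact_additive_eq (F : U -> U) k :
  {morph F : u u' / u + u'} -> (forall x u, F (clact x u) = clact x (F u)) ->
  (forall T : stdtab n lam, F (v (val T)) = k *: v (val T)) ->
  forall u, F u = k *: u.
Proof.
move=> FD Fx Fv u; have F0 : F 0 = 0 by apply: (addrI (F 0)); rewrite -FD !addr0.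
rewrite [in LHS](Uspace_expand u) [in RHS](Uspace_expand u) (big_morph _ FD F0).
by rewrite scaler_sumr; apply: eq_bigr => T _; rewrite Fx Fv clactZr.
Qed.

Lemma spin_op_clact a x u : spin_op a (clact x u) = clact (clhat x) (spin_op a u).
Proof.
rewrite !spin_opE /t_fun clact_sumr; apply: eq_bigr => T _.
by rewrite ffunE clhatM -mulrA -clactM.
Qed.

(** The product of [y_a] and the diagonal coefficient of [s_a v_T]. *)
Definition tau a d : Cl :=
  let k := kappa d (entry0 a) in let k1 := kappa d (entry1 a) in
  (sqrtC 2 / (k ^+ 2 - k1 ^+ 2)) *: (k *: c a - k1 *: c a.+1).

Lemma spin_op_vvec a d : standard lam d ->
  spin_op a (v d) = clact (tau a d) (v d) + Y a d *: clact (y a) (v (swap a d)).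
Proof.
move=> std; have [la lb] := entry_ltn a.
pose T : stdtab n lam := Sub d std.
have -> : spin_op a (v d) = clact (y a) (s_on_v C lam a d).
  rewrite spin_opE /t_fun (bigD1 T) //= big1 ?addr0 => [|T' nT].
    by rewrite ffunE eqxx clhat1 mul1r.
  have /negPf nT' : val T' != d by rewrite -[d]/(val T) (inj_eq val_inj).
  by rewrite ffunE nT' clhat0 mul0r clact0l.
rewrite /s_on_v clactDr clactZr clactM; congr (clact _ _ + _).
have := kappa_consecutive C hlam a std; rewrite /tau.
set k := kappa d (entry0 a); set k1 := kappa d (entry1 a) => kk.
have : k ^+ 2 - k1 ^+ 2 != 0 by rewrite subr_eq0.
rewrite subr_sqr mulf_eq0 negb_or => /andP[m p].
have m' : k1 - k != 0 by rewrite -oppr_eq0 opprB.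
have p' : k1 + k != 0 by rewrite addrC.
have yc : y a * (c a * c a.+1) = (sqrtC 2)^-1 *: (c a + c a.+1).
  rewrite /ygen -scalerAl mulrBl mulrA (cgen_anti_nat C lb la) ?gtn_eqF //.
  rewrite mulNr -!mulrA (cgen_sqr_nat C lb) mulrN1 opprK mulrA (cgen_sqr_nat C la).
  by rewrite mulN1r opprK.
rewrite mulrDr -!scalerAr mulr1 yc /ygen !scalerA.
have comb (r s : C) : r *: (c a.+1 - c a) + s *: (c a + c a.+1)
    = (s - r) *: c a + (r + s) *: c a.+1.
  rewrite scalerBr scalerDr scalerBl scalerDl [X in X + _ = _]addrC addrACA.
  by rewrite [X in X + _ = _]addrC.
rewrite comb scalerBr !scalerA -scaleNr.
have s2 : sqrtC 2 = 2 / sqrtC 2 :> C by rewrite -{2}(sqrtCK 2) expr2 mulfK ?sqrtC2_neq0.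
by rewrite [in RHS]s2; congr (_ *: _ + _ *: _); field; rewrite ?m ?p ?m' ?p' ?sqrtC2_neq0.
Qed.

Lemma ygen_tau a d : y a * tau a d = - (tau a (swap a d) * y a).
Proof.
have [la lb] := entry_ltn a.
have := ygen_cgen C lb la; have := ygen_cgen C lb lb.
rewrite /transp !eqxx gtn_eqF // /tau kappa_swap0 kappa_swap1 /=.
move: (y a) => z z1 z0; rewrite -scalerAr -[X in _ = - X]scalerAl.
rewrite -[kappa d (entry1 a) ^+ 2 - _]opprB invrN mulrN scaleNr opprK.
congr (_ *: _).
by rewrite mulrBr mulrBl -!scalerAr -!scalerAl z0 z1 !scalerN opprK addrC.
Qed.

Lemma tau_sqr a d : standard lam d ->
  tau a d * tau a d = (Y a d ^+ 2 - 1) *: 1.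
Proof.
move=> std; have [la lb] := entry_ltn a.
have kk := kappa_consecutive C hlam a std.
rewrite Ycoef_sq AcoefE // /tau -scalerAl -scalerAr scalerA.
set k := kappa d (entry0 a) in kk *; set k1 := kappa d (entry1 a) in kk *.
have -> : (k *: c a - k1 *: c a.+1) * (k *: c a - k1 *: c a.+1)
          = - (k ^+ 2 + k1 ^+ 2) *: 1.
  rewrite mulrBr !mulrBl -!scalerAr -!scalerAl !scalerA !cgen_sqr_nat //.
  rewrite (@cgen_anti_nat _ _ a.+1 a) ?gtn_eqF // [(k * k1) *: - _]scalerN opprK.
  rewrite [k1 * k]mulrC opprB addrA addrAC addrK -scalerDl scalerN -scaleNr.
  by rewrite -!expr2.
have : k ^+ 2 - k1 ^+ 2 != 0 by rewrite subr_eq0.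
rewrite scalerA => D0; congr (_ *: _); rewrite mulf_div -expr2 sqrtCK.
by field.
Qed.

Lemma clhat_tau a d : clhat (tau a d) = - tau a d.
Proof.
have [la lb] := entry_ltn a.
by rewrite /tau clhatZ clhatD clhatN !clhatZ !clhat_cgen // !scalerN -opprD scalerN.
Qed.

Lemma clhat_ygen a : clhat (y a) = - y a.
Proof.
have [la lb] := entry_ltn a.
by rewrite /ygen clhatZ clhatD clhatN !clhat_cgen // -opprD scalerN.
Qed.

(** The off-diagonal terms cancel by [ygen_tau], and the diagonal ones add up to [1]
    by [tau_sqr]; if [s_a T] is not standard, [Y_a] vanishes. *)
Lemma spin_op_sqr a u : spin_op a (spin_op a u) = u.
Proof.
rewrite -[RHS]scale1r; move: u; apply: clact_additive_eq => [u u'|x u|[d std]].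
- by rewrite !linearD.
- by rewrite !spin_op_clact clhatK.
rewrite /= spin_op_vvec // linearD linearZ /=.
rewrite !spin_op_clact !(spin_op_vvec a std) clactDr clactZr !clactM.
have [la lb] := entry_ltn a.
rewrite clhat_tau clhat_ygen !mulNr !clactNl tau_sqr // clactZl clact1l.
have [stds|nstd] := boolP (standard lam (swap a d)); last first.
  have Y0 : Y a d = 0 by apply/eqP; rewrite Ycoef_eq0.
  by rewrite Y0 !scale0r !addr0 expr0n sub0r scaleN1r opprK scale1r.
rewrite (spin_op_vvec a stds) swapK Ycoef_swap clactDr clactZr !clactM ygen_sqr //.
rewrite ygen_tau swapK !clactNl clact1l.
set w := clact _ (v (swap a d)); rewrite opprD opprK scalerDr !scalerN opprK.
by rewrite scalerA -expr2 addrA subrK scalerBl opprB subrK.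
Qed.

(** The Jucys-Murphy element of the entry [b], defined by its eigenvalue
    [kappa_b(T) c_b] on [v_T]; [spin_op_jm] ties it to the generators. *)
Definition jm b u : U :=
  [ffun T : stdtab n lam => clhat (u T) * (kappa (val T) b *: c b)].

Lemma jmD b : {morph jm b : u u' / u + u'}.
Proof. by move=> u u'; apply/ffunP => T; rewrite !ffunE clhatD mulrDl. Qed.

Lemma jmZ b k u : jm b (k *: u) = k *: jm b u.
Proof. by apply/ffunP => T; rewrite !ffunE clhatZ scalerAl. Qed.

Lemma jm_clact b x u : jm b (clact x u) = clact (clhat x) (jm b u).
Proof. by apply/ffunP => T; rewrite !ffunE clhatM mulrA. Qed.

Lemma jm_vvec b d : jm b (v d) = clact (kappa d b *: c b) (v d).
Proof.
apply/ffunP => T; rewrite !ffunE; case: eqP => [->|_].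
  by rewrite clhat1 mul1r mulr1.
by rewrite clhat0 mul0r mulr0.
Qed.

Lemma jm_first b u : b = 0%N :> nat -> jm b u = 0.
Proof.
move=> b0; apply/ffunP => T; rewrite !ffunE.
have /eqP -> : kappa (val T) b == 0.
  by rewrite kappa_eq0 (content_first hlam (valP T) b0).
by rewrite scale0r mulr0.
Qed.

(** The affine Hecke-Clifford relation between [t_a] and two consecutive
    Jucys-Murphy elements. *)
Lemma spin_op_jm a u :
  spin_op a (jm (entry0 a) u) + jm (entry1 a) (spin_op a u) = sqrtC 2 *: u.
Proof.
move: u; apply: clact_additive_eq => [u u'|x u|[d std] /=].
- by rewrite !(jmD, linearD) addrACA.
- by rewrite !(jm_clact, spin_op_clact) !clhatK clactDr.
have [la lb] := entry_ltn a.
rewrite jm_vvec spin_op_clact spin_op_vvec // jmD jmZ !jm_clact !jm_vvec kappa_swap1.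
set k := kappa d (entry0 a); set k1 := kappa d (entry1 a).
have c0N : clhat (k *: c (entry0 a)) = - (k *: c a).
  by rewrite clhatZ clhat_cgen // scalerN.
rewrite c0N clhat_ygen clhat_tau !clactNl clactDr clactZr !clactM opprD addrACA.
have yc : y a * (k *: c (entry1 a)) = - (k *: c a * y a).
  have := ygen_cgen C lb lb; rewrite /transp eqxx gtn_eqF //.
  by move: (y a) => z zE; rewrite -scalerAr zE -scalerAl scalerN.
rewrite yc clactNl opprK [X in _ + X]addrC subrr addr0 -opprD -clactDl.
suff -> : k *: c a * tau a d + tau a d * (k1 *: c (entry1 a)) = - sqrtC 2 *: 1.
  by rewrite clactZl clact1l scaleNr opprK.
rewrite /tau -/k -/k1 /= -[X in X + _]scalerAr -[X in _ + X]scalerAl -scalerDr.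
have -> : k *: c a * (k *: c a - k1 *: c a.+1)
    + (k *: c a - k1 *: c a.+1) * (k1 *: c a.+1) = - (k ^+ 2 - k1 ^+ 2) *: 1.
  rewrite mulrBr mulrBl addrA subrK -!scalerAl -!scalerAr !scalerA !cgen_sqr_nat //.
  by rewrite -scalerBl !scalerN -scaleNr !expr2.
have := kappa_consecutive C hlam a std; rewrite -/k -/k1 -subr_eq0 => kk.
by rewrite scalerA mulrN divfK.
Qed.

Lemma thetaE d : theta d = clact (Theta C d) (v d).
Proof. by []. Qed.

(** Conjugation by [Theta d] turns [c_b] into [c_(d^-1 b)]; its sign cancels that of
    [clhat (Theta d)]. *)
Lemma jm_theta b x d :
  jm b (clact x (theta d))
  = clact (clhat x * (kappa d b *: c (reg_entry d b))) (theta d).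
Proof.
rewrite jm_clact thetaE jm_clact clhat_Theta jm_vvec !clactM.
congr (clact _ _); rewrite -!mulrA; congr (_ * _).
rewrite -[LHS]scalerAl -[X in _ *: X = _]scalerAr Theta_cgen -[RHS]scalerAl.
by rewrite [X in _ *: X = _]scalerA mulrC -[X in _ *: X = _]scalerA signZK.
Qed.

(** The diagonal term is obtained by moving [Theta d] to the right of [tau], the other
    one by absorbing [y_a] into [Theta d]. *)
Lemma spin_op_theta a d : standard lam d ->
  spin_op a (theta d) = clact (t_coef C lam a d) (theta d)
    + ((-1) ^+ eps_exponent a d * Y a d) *: theta (swap a d).
Proof.
move=> std; rewrite !thetaE spin_op_clact spin_op_vvec // clhat_Theta clactDr clactZr.
rewrite !clactM; congr (_ + _); last first.
  by rewrite -scalerAl Theta_swap clactZl scalerA mulrC.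
congr (clact _ _); rewrite /tau /t_coef /= -[LHS]scalerAr -[RHS]scalerAl.
congr (_ *: _); rewrite -[LHS]scalerAl mulrBr mulrBl -!scalerAr -!scalerAl.
rewrite (Theta_cgen C d (entry0 a)) (Theta_cgen C d (entry1 a)).
have sgn k (w : Cl) : (-1) ^+ inversions d *: (k *: ((-1) ^+ inversions d *: w)) = k *: w.
  by rewrite scalerA mulrC -scalerA signZK.
by rewrite scalerBr !sgn.
Qed.

End Action.

(** * The elements F^delta *)

Lemma span_codomP (K : fieldType) (V : vectType K) (I : finType) (f : I -> V) x :
  reflect (exists a : I -> K, x = \sum_i a i *: f i) (x \in <<codom f>>%VS).
Proof.
apply: (iffP idP) => [fx|[a ->]]; last first.
  by apply: memv_suml => i _; apply/memvZ/memv_span/codom_f.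
pose X := [tuple of codom f].
exists (fun i => coord X (enum_rank i) x).
rewrite [LHS](coord_span (X := X)) //.
rewrite (reindex (@enum_rank I)); last exact/onW_bij/enum_rank_bij.
by apply: eq_bigr => i _; rewrite nth_codom enum_rankK.
Qed.

Section DeltaIndex.
Variables (n : nat) (lam : seq nat).
Local Notation m := (n - size lam)%N.
Local Notation p := (n - size lam)./2.
Local Notation delta := (delta_index n lam).
Implicit Types (f : 'I_p -> bool) (dl : delta).

Lemma pair_lt a : (a < p)%N -> (a.*2 < m)%N /\ (a.*2.+1 < m)%N.
Proof. by move=> ap; have := odd_double_half m; split; lia. Qed.

Definition flip (j : nat) f : 'I_p -> bool := fun a => (a == j./2 :> nat) (+) f a.

(** The change of [delta] under right multiplication by [c_(b_(j+1))]: the indices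
    [2 a] and [2 a + 1] act on the sign [delta_a], the index [2 p] on [alpha]. *)
Definition dflip (j : nat) dl : delta :=
  ([ffun a => flip j dl.1 a], if j == p.*2 then inord (1 - dl.2) else dl.2).

Lemma delta2_le dl : (dl.2 <= odd m)%N.
Proof. by rewrite -ltnS; apply: ltn_ord. Qed.

Lemma delta2_case dl : (dl.2 = 0 :> nat)%N \/ (dl.2 = 1 :> nat)%N /\ (p.*2 < m)%N.
Proof.
move: (nat_of_ord dl.2) (delta2_le dl) => k; have := odd_double_half m.
by case: (odd m) => h le; [case: k le => [|[]] // _; [left|right; lia]|left; lia].
Qed.

(** The coordinates are adjusted one at a time. *)
Lemma dflip_ind (P : delta -> Prop) dl0 :
  (forall dl j, (j < m)%N -> P dl -> P (dflip j dl)) -> P dl0 -> forall dl, P dl.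
Proof.
move=> Pf P0 [g al].
have E : P (g, dl0.2).
  have Es (s : seq 'I_p) : P ([ffun a => if a \in s then g a else dl0.1 a], dl0.2).
    elim: s => [|a s IH].
      suff -> : [ffun a : 'I_p => if a \in [::] then g a else dl0.1 a] = dl0.1.
        by rewrite -surjective_pairing.
      by apply/ffunP => a; rewrite ffunE.
    have [E|nE] := eqVneq (g a) (if a \in s then g a else dl0.1 a).
      congr (P (_, _)): IH; apply/ffunP => a'; rewrite !ffunE inE.
      by case: eqP => // ->; rewrite -E.
    have := Pf _ a.*2 (proj1 (pair_lt (ltn_ord a))) IH.
    rewrite /dflip ltn_eqF ?ltn_double ?ltn_ord //=.
    congr (P (_, _)); apply/ffunP => a'; rewrite !ffunE /flip ffunE doubleK inE.
    rewrite (inj_eq val_inj); case: eqP => [->|//] /=.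
    by move: nE; case: (g a); case: (if _ then _ else _).
  congr (P (_, _)): (Es (enum 'I_p)).
  by apply/ffunP => a; rewrite ffunE mem_enum.
have [->//|nal] := eqVneq al dl0.2.
have [m_odd pm] : odd m /\ (p.*2 < m)%N.
  move: nal (delta2_le (g, al)) (delta2_le dl0); rewrite -val_eqE /=.
  move: (nat_of_ord al) (nat_of_ord dl0.2) (odd_double_half m) => i j.
  by case: (odd m); lia.
have := Pf _ _ pm E; rewrite /dflip eqxx.
congr (P (_, _)).
  by apply/ffunP => a; rewrite ffunE /flip doubleK ltn_eqF ?ltn_ord.
apply: val_inj; rewrite /= inordK ?m_odd; last by lia.
by have := delta2_le (g, al); have := delta2_le dl0; move: nal; rewrite -val_eqE /=; lia.
Qed.

End DeltaIndex.

Section Fdelta.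
Variables (C : numClosedFieldType) (n : nat) (lam : seq nat).
Hypothesis hlam : strict_partition n lam.
Local Notation Cl := (Cl C n).
Local Notation c := (cgen C n).
Local Notation e j := (cb C n lam)`_j.
Local Notation m := (n - size lam)%N.
Local Notation p := (n - size lam)./2.
Local Notation Fd := (@Fdelta C n lam).
Local Notation delta := (delta_index n lam).
Implicit Types (x z : Cl) (s : seq 'I_p) (f : 'I_p -> bool) (dl : delta).

Lemma cbE j : (j < m)%N -> exists2 b : 'I_n, b \in nondiag n lam &
  e j = c b /\ index b (nondiag n lam) = j.
Proof.
rewrite -(size_nondiag hlam) => jm; have n0 : (0 < n)%N.
  by apply: leq_ltn_trans (leq0n j) (leq_trans jm _); rewrite size_nondiag ?leq_subr.
pose b := nth (Ordinal n0) (nondiag n lam) j; exists b; first exact: mem_nth.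
by rewrite /cb (nth_map (Ordinal n0)) // index_uniq // uniq_nondiag.
Qed.

Lemma cb_sqr j : (j < m)%N -> e j * e j = -1.
Proof. by case/cbE=> b _ [-> _]; apply: cgen_sqr. Qed.

Lemma cb_anti j k : (j < m)%N -> (k < m)%N -> j != k -> e j * e k = - (e k * e j).
Proof.
move=> /cbE[b _ [-> bj]] /cbE[b' _ [-> bk]] jk; apply: cgen_anti.
by apply: contra jk => /eqP E; rewrite -bj -bk E.
Qed.

Lemma clhat_cb j : (j < m)%N -> clhat (e j) = - e j.
Proof. by case/cbE=> b _ [-> _]; apply: clhat_cgen. Qed.

Lemma cb_of b : b \in nondiag n lam -> exists2 j, (j < m)%N & c b = e j.
Proof.
move=> bn; exists (index b (nondiag n lam)); first by rewrite -(size_nondiag hlam) index_mem.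
by rewrite /cb (nth_map b) ?index_mem // nth_index.
Qed.

Lemma Fplus_even a : (a < p)%N -> Fplus C n lam a * e a.*2 = Fminus C n lam a.
Proof.
case/pair_lt=> l0 l1; rewrite /Fplus /Fminus mulrDl mul1r -scalerAl -mulrA.
rewrite [e a.*2.+1 * _]cb_anti ?gtn_eqF // mulrN mulrA cb_sqr //.
by rewrite mulN1r opprK.
Qed.

Lemma Fplus_odd a : (a < p)%N ->
  Fplus C n lam a * e a.*2.+1 = - 'i *: Fminus C n lam a.
Proof.
case/pair_lt=> l0 l1; rewrite /Fplus /Fminus mulrDl mul1r -scalerAl -mulrA.
rewrite cb_sqr // mulrN1 scalerDr scalerN scalerA -scaleNr addrC.
by congr (_ + _); rewrite mulNr -expr2 sqrCi opprK scale1r.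
Qed.

Lemma Fminus_even a : (a < p)%N -> Fminus C n lam a * e a.*2 = - Fplus C n lam a.
Proof.
case/pair_lt=> l0 l1; rewrite /Fplus /Fminus mulrDl -scalerAl cb_sqr //.
by rewrite [e a.*2.+1 * _]cb_anti ?gtn_eqF // scalerN opprD.
Qed.

Lemma Fminus_odd a : (a < p)%N ->
  Fminus C n lam a * e a.*2.+1 = - 'i *: Fplus C n lam a.
Proof.
case/pair_lt=> l0 l1; rewrite /Fplus /Fminus mulrDl -scalerAl cb_sqr //.
rewrite scalerDr scalerA mulNr -expr2 sqrCi opprK scale1r addrC.
by rewrite scaleNr scalerN.
Qed.

Definition Ffactor (b : bool) a : Cl := if b then Fminus C n lam a else Fplus C n lam a.

Lemma Ffactor_cb b a j : (a < p)%N -> (j == a.*2) || (j == a.*2.+1) ->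
  exists2 k : C, k != 0 & Ffactor b a * e j = k *: Ffactor (~~ b) a.
Proof.
move=> ap; have i0 : 'i != 0 :> C by exact: neq0Ci.
case/orP=> /eqP->; case: b; rewrite /Ffactor /=.
- by exists (-1); rewrite ?oppr_eq0 ?oner_eq0 // Fminus_even // scaleN1r.
- by exists 1; rewrite ?oner_eq0 // Fplus_even // scale1r.
- by exists (- 'i); rewrite ?oppr_eq0 // Fminus_odd.
by exists (- 'i); rewrite ?oppr_eq0 // Fplus_odd.
Qed.

Lemma Ffactor_cb_far b a j : (a < p)%N -> (j < m)%N -> j != a.*2 -> j != a.*2.+1 ->
  Ffactor b a * e j = (-1) ^+ b *: (e j * Ffactor b a).
Proof.
move=> /pair_lt[l0 l1] lj j0 j1; have n0 : a.*2 != j by rewrite eq_sym.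
have n1 : a.*2.+1 != j by rewrite eq_sym.
case: b; rewrite /Ffactor /Fminus /Fplus mulrDl mulrDr -scalerAl -scalerAr.
  by rewrite (cb_anti l0 lj n0) (cb_anti l1 lj n1) scalerN -opprD scaleN1r.
rewrite scale1r mul1r mulr1 -mulrA (cb_anti l1 lj n1) mulrN mulrA.
by rewrite (cb_anti l0 lj n0) mulNr opprK mulrA.
Qed.

(** [1 + i c c'] and [1 - i c c'] add up to [2], and the latter is [- c (c + i c')]. *)
Lemma Ffactor_unit a : (a < p)%N -> Ffactor false a - e a.*2 * Ffactor true a = 2.
Proof.
case/pair_lt=> l0 l1; rewrite /Ffactor /Fplus /Fminus mulrDr cb_sqr // -scalerAr.
by rewrite opprD opprK addrACA subrr addr0.
Qed.

Lemma clhat_Ffactor b a : (a < p)%N -> clhat (Ffactor b a) = (-1) ^+ b *: Ffactor b a.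
Proof.
case/pair_lt=> l0 l1; case: b; rewrite /Ffactor /Fplus /Fminus clhatD clhatZ.
  by rewrite !clhat_cb // scalerN -opprD scaleN1r.
by rewrite clhatM clhat1 !clhat_cb // mulrNN scale1r.
Qed.

Definition Fprod s f : Cl := \prod_(a <- s) Ffactor (f a) a.

Lemma FdeltaE dl : Fd dl = Fprod (index_enum _) dl.1 * e p.*2 ^+ dl.2.
Proof. by []. Qed.

Lemma Fprod_cb_far s f j : (j < m)%N -> (forall a, a \in s -> a != j./2 :> nat) ->
  exists k, Fprod s f * e j = (-1) ^+ k *: (e j * Fprod s f).
Proof.
move=> jm; rewrite /Fprod; elim: s => [|a s IH] sj.
  by exists 0%N; rewrite !big_nil mulr1 mul1r scale1r.
have [|k E] := IH; first by move=> a' a's; apply: sj; rewrite inE a's orbT.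
have aj : a != j./2 :> nat by apply: sj; rewrite inE eqxx.
exists (f a + k)%N; rewrite !big_cons -mulrA E -scalerAr [Ffactor _ _ * (_ * _)]mulrA.
rewrite Ffactor_cb_far //; last 2 first.
- by move: aj; lia.
- by move: aj; lia.
by rewrite -scalerAl scalerA -mulrA addnC exprD.
Qed.

Lemma Fprod_cb s f (a : 'I_p) j : (j < m)%N -> uniq s -> a \in s -> a = j./2 :> nat ->
  exists2 k : C, k != 0 & Fprod s f * e j = k *: Fprod s (flip j f).
Proof.
move=> jm + + aj; elim: s => [|a' s IH] //= /andP[nas us].
have j_a : (j == a.*2) || (j == a.*2.+1).
  by have := odd_double_half j; rewrite -aj; case: odd; lia.
rewrite inE /Fprod !big_cons; case: eqVneq nas => [<- nas _|na nas /= a_s].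
  have [k E] : exists k, Fprod s f * e j = (-1) ^+ k *: (e j * Fprod s f).
    apply: Fprod_cb_far => // a'' a''s; rewrite -aj.
    by apply: contraNneq nas => /val_inj<-.
  have [k' k'0 E'] := Ffactor_cb (f a) (ltn_ord a) j_a.
  exists ((-1) ^+ k * k'); first by rewrite mulf_neq0 ?signr_eq0.
  rewrite -mulrA [_ * e j]E -scalerAr mulrA E' -scalerAl scalerA; congr (_ *: _).
  congr (_ * _); first by rewrite /flip aj eqxx.
  apply: eq_big_seq => a'' a''s; rewrite /flip -aj.
  by case: eqP => // /val_inj E''; rewrite -E'' a''s in nas.
have [k k0 E] := IH us a_s; exists k => //.
rewrite -mulrA [_ * e j]E -scalerAr /flip -aj.
by rewrite (inj_eq val_inj) eq_sym (negPf na).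
Qed.

Lemma cb_last_far dl j : (j < p.*2)%N -> (j < m)%N -> 
  e p.*2 ^+ dl.2 * e j = (-1) ^+ dl.2 *: (e j * e p.*2 ^+ dl.2).
Proof.
move=> jp jm; have [->|[-> pm]] := delta2_case dl.
  by rewrite !expr0 mulr1 mul1r scale1r.
by rewrite !expr1 cb_anti ?gtn_eqF // scaleN1r.
Qed.

Lemma Fdelta_cb dl j : (j < m)%N ->
  exists2 k : C, k != 0 & Fd dl * e j = k *: Fd (dflip j dl).
Proof.
move=> jm; rewrite !FdeltaE -mulrA /=.
have flipE s : Fprod s [ffun a => flip j dl.1 a] = Fprod s (flip j dl.1).
  by apply: eq_bigr => a _; rewrite ffunE.
have [jp|jp|jp] := ltngtP j p.*2; rewrite flipE; last 2 first.
- by exfalso; have := odd_double_half m; case: (odd m); lia.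
- have m_odd : odd m by have := odd_double_half m; case: odd => //; lia.
  have -> : Fprod (index_enum _) (flip j dl.1) = Fprod (index_enum _) dl.1.
    apply: eq_bigr => a _; rewrite /flip jp doubleK.
    by rewrite ltn_eqF ?ltn_ord.
  have [d0|[d1 _]] := delta2_case dl.
    by exists 1; rewrite ?oner_eq0 // inordK d0 ?m_odd // jp expr0 mul1r scale1r.
  exists (-1); rewrite ?oppr_eq0 ?oner_eq0 // inordK d1 ?m_odd // jp.
  by rewrite expr1 cb_sqr -?jp // mulrN1 mulr1 scaleN1r.
have jp2 : (j./2 < p)%N by have := odd_double_half j; lia.
rewrite cb_last_far // -scalerAr mulrA.
have [k k0 ->] := Fprod_cb dl.1 jm (index_enum_uniq _) (mem_index_enum (Ordinal jp2)) erefl.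
exists ((-1) ^+ dl.2 * k); first by rewrite mulf_neq0 ?signr_eq0.
by rewrite -scalerAl scalerA.
Qed.

Lemma Ffactor_pair b a : (a < p)%N ->
  Ffactor b a * (e a.*2 * e a.*2.+1) = (if b then 'i else - 'i) *: Ffactor b a.
Proof.
move=> ap; rewrite mulrA; case: b; rewrite /Ffactor.
  by rewrite Fminus_even // mulNr Fplus_odd // scaleNr opprK.
by rewrite Fplus_even // Fminus_odd.
Qed.

(** The product of two paired generators is even and commutes with the factors of the
    other pairs, so only the factor of its own pair matters. *)
Lemma Fdelta_pair dl (a : 'I_p) :
  Fd dl * (e a.*2 * e a.*2.+1) = (if dl.1 a then 'i else - 'i) *: Fd dl.
Proof.
rewrite !FdeltaE -mulrA; have [l0 l1] := pair_lt (ltn_ord a).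
have ap := ltn_ord a.
have -> : e p.*2 ^+ dl.2 * (e a.*2 * e a.*2.+1)
          = (e a.*2 * e a.*2.+1) * e p.*2 ^+ dl.2.
  rewrite mulrA cb_last_far ?ltn_double // -[LHS]scalerAl -[X in _ *: X = _]mulrA.
  rewrite (@cb_last_far dl a.*2.+1) //; last by lia.
  by rewrite -scalerAr signZK mulrA.
rewrite mulrA [RHS]scalerAl; congr (_ * _).
have far s f : a \notin s ->
    Fprod s f * (e a.*2 * e a.*2.+1) = (e a.*2 * e a.*2.+1) * Fprod s f.
  rewrite /Fprod; elim: s => [|a' s IH]; first by rewrite big_nil mulr1 mul1r.
  rewrite inE negb_or => /andP[na nas]; rewrite !big_cons -mulrA IH // !mulrA.
  have {}na : a != a' :> nat by [].
  congr (_ * _); rewrite Ffactor_cb_far ?ltn_ord //; try lia.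
  rewrite -[LHS]scalerAl -[X in _ *: X = _]mulrA Ffactor_cb_far ?ltn_ord //; try lia.
  by rewrite -scalerAr signZK mulrA.
move: (index_enum_uniq 'I_p) (mem_index_enum a).
elim: (index_enum _) => //= a' s IH /andP[nas us]; rewrite inE /Fprod !big_cons.
case: eqVneq nas => [<- nas _|na nas /= a_s].
  by rewrite -mulrA [X in _ * X]far // mulrA Ffactor_pair // scalerAl.
by rewrite -mulrA [X in _ * X]IH // scalerAr.
Qed.

Lemma clhat_Fdelta dl : clhat (Fd dl) = (-1) ^+ delta_parity dl *: Fd dl.
Proof.
rewrite !FdeltaE clhatM /delta_parity exprD -scalerA scalerAr scalerAl; congr (_ * _).
  have -> : #|[set a | dl.1 a]| = (\sum_(a <- index_enum _) dl.1 a)%N.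
    by rewrite -sum1dep_card big_mkcond; apply: eq_bigr => a _; case: (dl.1 a).
  rewrite /Fprod; elim: index_enum => [|a s IH]; first by rewrite !big_nil clhat1 scale1r.
  rewrite !big_cons clhatM IH clhat_Ffactor ?ltn_ord // exprD -scalerA.
  by rewrite -scalerAl -scalerAr.
have [->|[-> pm]] := delta2_case dl; first by rewrite !expr0 clhat1 scale1r.
by rewrite !expr1 clhat_cb // scaleN1r.
Qed.

(** By [Ffactor_unit], the product of all factors but the first lies in the left ideal
    as soon as it does with both choices of the first; the factors are removed in
    turn. *)
Lemma Fdelta_generate (L : Cl -> Prop) :
  (forall x z, L x -> L z -> L (x + z)) -> (forall x z, L z -> L (x * z)) ->
  (forall dl, L (Fd dl)) -> L 1.
Proof.
move=> LD LM LF.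
suff gen s : uniq s -> (forall f, L (Fprod s f)) -> L 1.
  apply: (gen (index_enum _)) (index_enum_uniq _) _ => f.
  have := LF ([ffun a => f a], ord0); rewrite FdeltaE mulr1.
  by congr (L _); apply: eq_bigr => a _; rewrite ffunE.
elim: s => [_ /(_ (fun=> true))|a s IH /andP[nas us] Ls]; first by rewrite /Fprod big_nil.
apply: IH => // f; pose f' b := fun a' => if a' == a then b else f a'.
have E b : Fprod (a :: s) (f' b) = Ffactor b a * Fprod s f.
  rewrite /Fprod big_cons /f' eqxx; congr (_ * _); apply: eq_big_seq => a' a's.
  by case: eqP => // aa; rewrite -aa a's in nas.
have : L (2^-1 *: 1 * (Ffactor false a * Fprod s f + - e a.*2 * (Ffactor true a * Fprod s f))).
  by rewrite -!E; apply: (LM); apply: LD => //; apply: (LM).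
congr (L _); rewrite mulNr mulrA -mulrBl Ffactor_unit ?ltn_ord // -scalerAl mul1r.
by rewrite mulr_natl -scaler_nat scalerA mulVf ?scale1r ?pnatr_eq0.
Qed.

(** Otherwise all of them would vanish, by [Fdelta_cb], although they generate the
    Clifford algebra. *)
Lemma Fdelta_neq0 dl : Fd dl != 0.
Proof.
apply/eqP => F0; suff F00 dl' : Fd dl' = 0.
  have : (1 : Cl) = 0.
    apply: (Fdelta_generate (L := fun x => x = 0)) => // [x z -> ->|x z ->].
      by rewrite addr0.
    by rewrite mulr0.
  by move/eqP; rewrite oner_eq0.
move: dl'; apply: (dflip_ind (P := fun dl => Fd dl = 0) _ F0) => dl' j jm E.
have [k k0] := Fdelta_cb dl' jm; rewrite E mul0r => /esym/eqP.
by rewrite scaler_eq0 (negPf k0) => /eqP.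
Qed.

Lemma Espan_cgen x b : x \in Espan C n lam -> b \in nondiag n lam ->
  x * c b \in Espan C n lam.
Proof.
move=> /span_codomP[a ->] /cb_of[j jm ->]; rewrite mulr_suml; apply: memv_suml => dl _.
have [k _ E] := Fdelta_cb dl jm; rewrite -scalerAl E scalerA.
by apply/memvZ/memv_span/codom_f.
Qed.

End Fdelta.

(** * Joint eigenvectors and the basis *)

(** If [chi_j] takes different values at [i] and [i'], then [P_j - chi_j(i')] removes
    the term [i'] and rescales the others, the term [i] by a nonzero scalar. *)
Lemma eigen_separation (K : fieldType) (V : vectType K) (W : {vspace V})
    (I : finType) (J : Type) (P : J -> V -> V) (chi : J -> I -> K) :
  (forall j, {morph P j : u w / u + w}) ->
  (forall j k u, P j (k *: u) = k *: P j u) ->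
  (forall j u, u \in W -> P j u \in W) ->
  (forall i i', i != i' -> exists j, chi j i != chi j i') ->
  forall f : I -> V, (forall j i, P j (f i) = chi j i *: f i) ->
  \sum_i f i \in W -> forall i, f i \in W.
Proof.
move=> PD PZ PW sep.
have P0 j : P j 0 = 0 by rewrite -[0 in LHS](scale0r (0 : V)) PZ scale0r.
suff main m (A : {set I}) f : (#|A| <= m)%N ->
    (forall j i, P j (f i) = chi j i *: f i) ->
    \sum_(i in A) f i \in W -> forall i, i \in A -> f i \in W.
  move=> f fP fW i; apply: (main #|I| [set: I]) => //; first exact: max_card.
  by congr (_ \in W): fW; apply: eq_bigl => j; rewrite inE.
elim: m A f => [|m IH] A f; first by rewrite leqn0 cards_eq0 => /eqP-> _ _ i; rewrite inE.
move=> Am fP fW i iA.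
have [/existsP[i' /andP[i'A ni]]|none] := boolP [exists i', (i' \in A) && (i' != i)]; last first.
  move: fW; rewrite (bigD1 i) //= big1 ?addr0 // => i' /andP[i'A ni].
  by case/existsP: none; exists i'; rewrite i'A.
have [|j chij] := sep i i'; first by rewrite eq_sym.
pose g i'' := (chi j i'' - chi j i') *: f i''.
have gW : \sum_(i'' in A :\ i') g i'' \in W.
  have -> : \sum_(i'' in A :\ i') g i''
      = P j (\sum_(i'' in A) f i'') - chi j i' *: \sum_(i'' in A) f i''.
    rewrite (big_morph _ (PD j) (P0 j)) scaler_sumr -sumrB [RHS](bigD1 i') //=.
    rewrite fP subrr add0r; apply: eq_big => [i''|i'' _]; first by rewrite !inE andbC.
    by rewrite /g scalerBl fP.
  by rewrite memvB ?memvZ ?PW.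
have : g i \in W.
  apply: (IH (A :\ i') g) => //; last by rewrite !inE eq_sym ni.
    by rewrite -ltnS; apply: leq_trans Am; rewrite [leqRHS](cardsD1 i') i'A.
  by move=> j' i''; rewrite PZ fP !scalerA mulrC.
by rewrite rpredZeq subr_eq0 (negPf chij).
Qed.

Section Basis.
Variables (C : numClosedFieldType) (n : nat) (lam : seq nat).
Hypothesis hlam : strict_partition n lam.
Local Notation Cl := (Cl C n).
Local Notation c := (cgen C n).
Local Notation y := (ygen C n).
Local Notation U := (Uspace C n lam).
Local Notation Uh := (Uhat C n lam).
Local Notation kappa := (kappa C lam).
Local Notation v := (vvec C lam).
Local Notation theta := (theta C lam).
Local Notation Y := (Ycoef C lam).
Local Notation Fd := (@Fdelta C n lam).
Local Notation delta := (delta_index n lam).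
Local Notation bv := (@basis_vector C n lam).
Local Notation W := (basis_span C n lam).
Local Notation E := (Espan C n lam).
Local Notation spin_op := (@spin_op C n lam).
Local Notation jm := (@jm C n lam).
Implicit Types (x z : Cl) (u : U) (d : 'S_n) (a : 'I_n.-1) (b : 'I_n) (dl : delta).

Definition uhat u : U := [ffun T : stdtab n lam => clhat (u T)].

Lemma uhatD : {morph uhat : u u' / u + u'}.
Proof. by move=> u u'; apply/ffunP => T; rewrite !ffunE clhatD. Qed.

Lemma uhatZ k u : uhat (k *: u) = k *: uhat u.
Proof. by apply/ffunP => T; rewrite !ffunE clhatZ. Qed.

Lemma uhat_clact x u : uhat (clact x u) = clact (clhat x) (uhat u).
Proof. by apply/ffunP => T; rewrite !ffunE clhatM. Qed.

Lemma uhat_vvec d : uhat (v d) = v d.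
Proof. by apply/ffunP => T; rewrite !ffunE; case: eqP; rewrite ?clhat1 ?clhat0. Qed.

Lemma uhatK : involutive uhat.
Proof. by move=> u; apply/ffunP => T; rewrite !ffunE clhatK. Qed.

Lemma uhat0 : uhat 0 = 0.
Proof. by rewrite -[0 in LHS](scale0r (0 : U)) uhatZ scale0r. Qed.

Lemma uhatN u : uhat (- u) = - uhat u.
Proof. by rewrite -scaleN1r uhatZ scaleN1r. Qed.

Lemma parity_span (P : pred {set 'I_n}) (s : bool) u :
  (forall A, P A = (odd #|A| == s)) ->
  reflect (uhat u = (-1) ^+ s *: u)
    (u \in (\sum_(T : stdtab n lam) \sum_(A : {set 'I_n} | P A)
       <[clact (clbasis C A) (v (val T))]>)%VS).
Proof.
move=> PE; apply: (iffP idP) => [/memv_sumP[w wT ->]|uE].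
  rewrite (big_morph _ uhatD uhat0) scaler_sumr; apply: eq_bigr => T _.
  have /memv_sumP[w' w'A ->] := wT T isT.
  rewrite (big_morph _ uhatD uhat0) scaler_sumr; apply: eq_bigr => A PA.
  have /vlineP[k ->] := w'A A PA.
  rewrite uhatZ uhat_clact uhat_vvec clhat_basis clactZl scalerA mulrC -scalerA.
  by rewrite -signr_odd; move: PA; rewrite PE => /eqP->.
rewrite [u]Uspace_expand; apply: memv_suml => T _.
apply: (subvP (sumv_sup T _ (subvv _))) => //.
rewrite {1}[u T]clbasis_expand clact_suml; apply: memv_suml => A _.
have [PA|nPA] := boolP (P A).
  by apply: (subvP (sumv_sup A PA (subvv _))); rewrite clactZl memvZ ?memv_line.
have : u T A = - u T A.
  have /ffunP/(_ T)/ffunP/(_ A) := uE; rewrite !ffunE -signr_odd => h.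
  move: h nPA; rewrite PE /GRing.scale /=; case: s {uE PE P}; case: (odd _) => //=.
    by rewrite expr0 mul1r expr1 mulN1r.
  by rewrite expr0 mul1r expr1 mulN1r => ->.
move/eqP; rewrite -addr_eq0 -mulr2n mulrn_eq0 /= => /eqP->.
by rewrite scale0r clact0l mem0v.
Qed.

Lemma evenP u : reflect (uhat u = u) (u \in rep_even Uh).
Proof.
have := @parity_span (fun A => ~~ odd #|A|) false u (fun A => _).
by rewrite scale1r; apply => A; rewrite eqbF_neg.
Qed.

Lemma oddP u : reflect (uhat u = - u) (u \in rep_odd Uh).
Proof.
have := @parity_span (fun A => odd #|A|) true u (fun A => _).
by rewrite scaleN1r; apply => A; rewrite eqb_id.
Qed.

Lemma Uhat_full : (rep_even Uh + rep_odd Uh)%VS = fullv.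
Proof.
apply/eqP; rewrite eqEsubv subvf; apply/subvP => u _.
have two : (2 : C) != 0 by rewrite pnatr_eq0.
have -> : u = 2^-1 *: (u + uhat u) + 2^-1 *: (u - uhat u).
  rewrite -scalerDr addrACA subrr addr0 -mulr2n -scaler_nat scalerA mulVf //.
  by rewrite scale1r.
apply: memv_add; [apply/evenP|apply/oddP]; rewrite uhatZ uhatD ?uhatN uhatK.
  by rewrite addrC.
by rewrite -scalerN opprB.
Qed.

Lemma Uhat_cap : (rep_even Uh :&: rep_odd Uh)%VS = 0%VS.
Proof.
apply/eqP; rewrite -subv0; apply/subvP => u /memv_capP[/evenP uE /oddP].
by rewrite uE => /eqP; rewrite -addr_eq0 -mulr2n -scaler_nat scaler_eq0 pnatr_eq0 memv0.
Qed.

Lemma basis_vectorE dl (T : stdtab n lam) : bv (dl, T) = clact (Fd dl) (theta (val T)).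
Proof. by []. Qed.

Lemma theta_nonstandard d : ~~ standard lam d -> theta d = 0.
Proof. by move=> nd; rewrite thetaE vvec_nonstandard // clact0r. Qed.

Lemma uhat_theta d : uhat (theta d) = (-1) ^+ inversions d *: theta d.
Proof. by rewrite thetaE uhat_clact uhat_vvec clhat_Theta clactZl. Qed.

Lemma uhat_basis dl T :
  uhat (bv (dl, T)) = (-1) ^+ (delta_parity dl + inversions (val T)) *: bv (dl, T).
Proof.
rewrite basis_vectorE uhat_clact uhat_theta (clhat_Fdelta C hlam).
by rewrite clactZl clactZr scalerA exprD.
Qed.

Lemma Espan_theta x (T : stdtab n lam) : x \in E -> clact x (theta (val T)) \in W.
Proof.
move=> /span_codomP[k ->]; rewrite clact_suml; apply: memv_suml => dl _.
by rewrite clactZl memvZ // memv_span // (codom_f bv (dl, T)).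
Qed.

(** A diagonal [reg_entry d b] has content [0], and then [kappa] vanishes. *)
Lemma Espan_kappa x d b : x \in E -> x * (kappa d b *: c (reg_entry d b)) \in E.
Proof.
move=> xE; have [nd|nd] := boolP (reg_entry d b \in nondiag n lam).
  by rewrite -scalerAr memvZ // (Espan_cgen hlam).
have /eqP -> : kappa d b == 0.
  by rewrite kappa_eq0; move: nd; rewrite (mem_nondiag hlam) negbK.
by rewrite scale0r mulr0 mem0v.
Qed.

Lemma Espan_t_coef x a d : x \in E -> x * t_coef C lam a d \in E.
Proof.
by move=> xE; rewrite /t_coef /= -scalerAr memvZ // mulrBr memvB // Espan_kappa.
Qed.

Lemma Fdelta_in dl : Fd dl \in E.
Proof. by rewrite memv_span // codom_f. Qed.

Lemma spin_op_basis a dl (T : stdtab n lam) :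
  spin_op a (bv (dl, T)) = (-1) ^+ delta_parity dl *:
    (clact (Fd dl * t_coef C lam a (val T)) (theta (val T))
     + ((-1) ^+ eps_exponent a (val T) * Y a (val T))
         *: clact (Fd dl) (theta (swap a (val T)))).
Proof.
rewrite basis_vectorE spin_op_clact spin_op_theta ?(valP T) // (clhat_Fdelta C hlam).
by rewrite clactZl clactDr clactZr clactM.
Qed.

Lemma spin_op_basis_in a dl T : spin_op a (bv (dl, T)) \in W.
Proof.
rewrite spin_op_basis memvZ // memvD ?Espan_theta ?Espan_t_coef ?Fdelta_in // memvZ //.
have [std|nstd] := boolP (standard lam (swap a (val T))).
  exact: (@Espan_theta _ (Sub (swap a (val T)) std) (Fdelta_in dl)).
by rewrite theta_nonstandard // clact0r mem0v.
Qed.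

Lemma basis_span_stable a u : u \in W -> spin_op a u \in W.
Proof.
move=> /span_codomP[k ->]; rewrite linear_sum; apply: memv_suml => -[dl T] _.
by rewrite linearZ memvZ // spin_op_basis_in.
Qed.

Lemma jm_basis b dl (T : stdtab n lam) : jm b (bv (dl, T))
  = (-1) ^+ delta_parity dl *:
    clact (Fd dl * (kappa (val T) b *: c (reg_entry (val T) b))) (theta (val T)).
Proof. by rewrite basis_vectorE jm_theta (clhat_Fdelta C hlam) -scalerAl clactZl. Qed.

Lemma kappa_nondiag (T : stdtab n lam) b : b \in nondiag n lam ->
  kappa (val T) (val T b) != 0.
Proof. by rewrite (mem_nondiag hlam) kappa_eq0 /reg_entry permK. Qed.

(** The Jucys-Murphy element of the entry of [T] at the box of [b_(j+1)] acts by
    right multiplication by a nonzero multiple of [c_(b_(j+1))]. *)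
Lemma jm_flip dl (T : stdtab n lam) j : (j < n - size lam)%N ->
  exists b, exists2 k : C, k != 0 & jm b (bv (dl, T)) = k *: bv (dflip j dl, T).
Proof.
move=> lj; have [b bn [bE _]] := cbE C hlam lj.
have [k k0 kE] := Fdelta_cb C hlam dl lj; exists (val T b).
exists ((-1) ^+ delta_parity dl * (kappa (val T) (val T b) * k)).
  by rewrite !mulf_neq0 ?signr_eq0 ?kappa_nondiag.
rewrite jm_basis /reg_entry permK -bE -scalerAr kE scalerA clactZl scalerA.
by rewrite -basis_vectorE.
Qed.

Lemma jm_sqr b x (T : stdtab n lam) :
  jm b (jm b (clact x (theta (val T)))) = kappa (val T) b ^+ 2 *: clact x (theta (val T)).
Proof.
rewrite jm_theta jm_theta clhatM clhatK clhatZ clhat_cgen // scalerN mulrN mulNr.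
have sq (w : 'I_n) (k : C) : k *: c w * (k *: c w) = - (k ^+ 2 *: 1).
  by rewrite -scalerAl -scalerAr scalerA cgen_sqr scalerN expr2.
by rewrite -mulrA sq mulrN opprK -scalerAr mulr1 clactZl.
Qed.

Lemma jm_pair (T : stdtab n lam) (a : 'I_((n - size lam)./2)) :
  exists bb : 'I_n * 'I_n, exists2 k : C, k != 0 & forall dl,
    jm bb.2 (jm bb.1 (bv (dl, T))) = (k * (if dl.1 a then 'i else - 'i)) *: bv (dl, T).
Proof.
have [l0 l1] := pair_lt (ltn_ord a).
have [b bn [bE _]] := cbE C hlam l0; have [b' bn' [bE' _]] := cbE C hlam l1.
exists (val T b, val T b') => /=.
exists (- (kappa (val T) (val T b) * kappa (val T) (val T b'))).
  by rewrite oppr_eq0 !mulf_neq0 ?kappa_nondiag.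
move=> dl; rewrite basis_vectorE !jm_theta clhatM clhatK /reg_entry !permK -bE -bE'.
have mv x z w (k k' : C) : x * (k *: - z) * (k' *: w) = - (k * k') *: (x * (z * w)).
  rewrite -[x * (k *: - z)]scalerAr -[LHS]scalerAr -scalerAl scalerA mulrN mulNr.
  by rewrite scalerN -scaleNr mulrC mulrA.
rewrite clhatZ (clhat_cb C hlam l0) mv (Fdelta_pair C hlam) scalerA clactZl.
by [].
Qed.

(** The squares of the Jucys-Murphy elements separate the tableaux by their contents;
    for a given tableau, products of two of them separate the signs in [delta], and
    the parity involution then separates the values of [alpha]. *)
Lemma basis_separation (W' : {vspace U}) (k : delta * stdtab n lam -> C) :
  (forall b u, u \in W' -> jm b u \in W') -> (forall u, u \in W' -> uhat u \in W') ->
  \sum_i k i *: bv i \in W' -> forall i, k i *: bv i \in W'.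
Proof.
move=> jmW uhatW kW [dl T].
pose f T' := \sum_dl' k (dl', T') *: bv (dl', T').
have fE T' : f T' = clact (\sum_dl' k (dl', T') *: Fd dl') (theta (val T')).
  by rewrite clact_suml; apply: eq_bigr => dl' _; rewrite clactZl basis_vectorE.
have fW : f T \in W'.
  apply: (@eigen_separation _ _ W' _ 'I_n (fun b u => jm b (jm b u))
    (fun b (T' : stdtab n lam) => kappa (val T') b ^+ 2)).
  - by move=> b u w; rewrite !jmD.
  - by move=> b r u; rewrite !jmZ.
  - by move=> b u uW; rewrite !jmW.
  - move=> T1 T2 n12; apply/existsP; apply: contraNT n12; rewrite negb_exists.
    move/forallP => h; apply/eqP/val_inj/(content_inj hlam (valP T1) (valP T2)) => b.
    by apply/eqP; rewrite -(kappa_sq_eq C); have := h b; rewrite negbK.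
  - by move=> b T'; rewrite !fE jm_sqr.
  have -> : \sum_T' f T' = \sum_i k i *: bv i.
    by rewrite /f exchange_big pair_big /=; apply: eq_bigr => -[].
  exact: kW.
have [bb bbP] := fin_all_exists (jm_pair T).
pose P (o : option 'I_((n - size lam)./2)) u :=
  if o is Some a then jm (bb a).2 (jm (bb a).1 u) else uhat u.
have [r r0 rE] := fin_all_exists2 bbP.
pose chi o (dl' : delta) : C := if o is Some a then r a * (if dl'.1 a then 'i else - 'i)
  else (-1) ^+ (delta_parity dl' + inversions (val T)).
have i0 : 'i != - 'i :> C.
  by rewrite -addr_eq0 -mulr2n mulrn_eq0 /= neq0Ci.
have sgn : 1 != -1 :> C by rewrite -addr_eq0 -mulr2n pnatr_eq0.
apply: (@eigen_separation _ _ W' _ _ P chi _ _ _ _ (fun dl' => k (dl', T) *: bv (dl', T)) _ fW dl).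
- by case=> [a|] u w /=; rewrite ?jmD ?uhatD.
- by case=> [a|] q u /=; rewrite ?jmZ ?uhatZ.
- by case=> [a|] u uW /=; rewrite ?jmW ?uhatW.
- move=> [f1 al1] [f2 al2]; rewrite xpair_eqE negb_and.
  have [-> /= nal|nf _] := eqVneq f1 f2.
    exists None; rewrite /= /delta_parity /= !exprD !(inj_eq (mulIf _)) ?signr_eq0 //.
    rewrite (inj_eq (mulfI _)) ?signr_eq0 //.
    have := ltn_ord al1; have := ltn_ord al2; move: nal; rewrite -val_eqE /=.
    move: (nat_of_ord al1) (nat_of_ord al2) => x1 x2 n12 l2 l1.
    have [[-> ->]|[-> ->]] : (x1 = 0 /\ x2 = 1 \/ x1 = 1 /\ x2 = 0)%N by lia.
      by rewrite expr0 expr1.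
    by rewrite expr0 expr1 eq_sym.
  have [a na] : exists a : 'I__, f1 a != f2 a.
    apply/existsP; apply: contraNT nf; rewrite negb_exists => /forallP h.
    by apply/eqP/ffunP => a; apply/eqP; have := h a; rewrite negbK.
  exists (Some a); rewrite /= (inj_eq (mulfI (r0 a))).
  move: na; case: (f1 a); case: (f2 a) => //= _; rewrite ?i0 //.
  by rewrite eq_sym.
case=> [a|] dl' /=; first by rewrite !jmZ rE !scalerA mulrC.
by rewrite uhatZ uhat_basis !scalerA mulrC.
Qed.

Lemma basis_vector_neq0 i : bv i != 0.
Proof.
case: i => dl T; apply/eqP => /ffunP/(_ T); rewrite basis_vectorE thetaE !ffunE eqxx mulr1.
have [z zE _] := Theta_inv C (val T).
move/(congr1 (fun x => x * z)); rewrite -mulrA zE mulr1 mul0r => /eqP.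
by rewrite (negPf (Fdelta_neq0 C hlam dl)).
Qed.

Lemma jm0 b : jm b 0 = 0.
Proof. by rewrite -[0 in LHS](scale0r (0 : U)) jmZ scale0r. Qed.

Lemma basis_free (k : delta * stdtab n lam -> C) :
  \sum_i k i *: bv i = 0 -> forall i, k i = 0.
Proof.
move=> k0 i; have : k i *: bv i \in (0%VS : {vspace U}).
  apply: basis_separation; last by rewrite k0 mem0v.
    by move=> b u; rewrite !memv0 => /eqP->; rewrite jm0.
  by move=> u; rewrite !memv0 => /eqP->; rewrite uhat0.
by rewrite memv0 scaler_eq0 (negPf (basis_vector_neq0 i)) orbF => /eqP.
Qed.

Lemma basis_of_basis_span : basis_of W (codom bv).
Proof.
apply/andP; split=> //; apply: (introT (@freeP _ _ _ (codom_tuple bv))) => k k0 i.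
have kE := @basis_free (fun j => k (enum_rank j)) _ (enum_val i).
move: kE; rewrite enum_valK; apply.
rewrite -[RHS]k0 (reindex (@enum_rank _)) /=; last exact/onW_bij/enum_rank_bij.
by apply: eq_bigr => j _; rewrite nth_codom enum_rankK.
Qed.

Lemma basis_span_neq0 : W <> 0%VS.
Proof.
move=> W0; have T : stdtab n lam := Sub 1%g (standard_id hlam).
have [dl] : exists dl : delta, true by exists ([ffun=> false], ord0).
have : bv (dl, T) \in W by rewrite memv_span ?codom_f.
by rewrite W0 memv0 (negPf (basis_vector_neq0 _)).
Qed.

End Basis.

(** * Simple modules inside a sum of translates *)

Section Supermodules.
Variables (K : fieldType) (G : Type).
Implicit Types M N V : superRep K G.

(** [true] stands for the odd part, so that parities add up with [(+)]. *)
Definition par M (b : bool) : {vspace M} := if b then rep_odd M else rep_even M.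

Definition superspace M : Prop :=
  (rep_even M + rep_odd M)%VS = fullv /\ (rep_even M :&: rep_odd M)%VS = 0%VS.

(** [graded_submodule] in terms of homogeneous components, see [graded_submoduleP]. *)
Definition submod M (W : {vspace M}) : Prop :=
  (forall b x z, x \in par M b -> z \in par M (~~ b) -> x + z \in W -> x \in W)
  /\ (forall g u, u \in W -> rep_op M g u \in W).

(** Homogeneous maps of parity [p]; the odd ones also commute with the generators, as
    in [embedding]. *)
Definition shom M N (p : bool) (f : 'Hom(M, N)) : Prop :=
  (forall g x, f (rep_op M g x) = rep_op N g (f x))
  /\ (forall b x, x \in par M b -> f x \in par N (b (+) p)).

Lemma par_split M b u : superspace M ->
  exists x z, [/\ x \in par M b, z \in par M (~~ b) & u = x + z].
Proof.
case=> full _; have := memvf u; rewrite -full => /memv_addP[x xM [z zM ->]].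
case: b; [exists z, x|exists x, z]; split=> //; exact: addrC.
Qed.

Lemma par_uniq M b x z x' z' : superspace M -> x \in par M b -> z \in par M (~~ b) ->
  x' \in par M b -> z' \in par M (~~ b) -> x + z = x' + z' -> x = x'.
Proof.
case=> _ cap xM zM x'M z'M E; apply/eqP; rewrite -subr_eq0 -memv0 -cap.
have E2 : x - x' = z' - z.
  by apply/eqP; rewrite subr_eq addrAC eq_sym subr_eq addrC -E.
have h1 : x - x' \in par M b by rewrite memvB.
have h2 : x - x' \in par M (~~ b) by rewrite E2 memvB.
by apply/memv_capP; case: b h1 h2 {xM zM x'M z'M}.
Qed.

Lemma graded_submoduleP M (W : {vspace M}) : superspace M ->
  graded_submodule W <-> submod W.
Proof.
move=> sM; split=> [[E st]|[cl st]]; split.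
- move=> b x z xM zM; rewrite {1}E => /memv_addP[w0 /memv_capP[w0W w0M]].
  case=> w1 /memv_capP[w1W w1M] E'; case: b xM zM => /= xM zM.
    rewrite [RHS]addrC in E'; suff -> : x = w1 by [].
    exact: (@par_uniq _ true) E'.
  suff -> : x = w0 by [].
  exact: (@par_uniq _ false) E'.
- move=> g u uW; have stg := st g; apply: (subvP stg); exact: memv_img.
- apply: subv_anti; rewrite subv_add !capvSl /= andbT; apply/subvP => u uW.
  have [x [z [xM zM uE]]] := par_split false u sM.
  rewrite uE in uW *; have xW := cl _ _ _ xM zM uW.
  have zW : z \in W by rewrite -(addKr x z) memvD // memvN.
  by apply: memv_add; apply/memv_capP.
by move=> g; apply/subvP => _ /memv_imgP[u uW ->]; apply: st.
Qed.

Lemma submod_add M (W1 W2 : {vspace M}) : superspace M ->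
  submod W1 -> submod W2 -> submod (W1 + W2)%VS.
Proof.
move=> sM [cl1 st1] [cl2 st2]; split=> [b x z xM zM|g u].
  move/memv_addP=> [w1 w1W [w2 w2W E]].
  have [x1 [z1 [x1M z1M E1]]] := par_split b w1 sM.
  have [x2 [z2 [x2M z2M E2]]] := par_split b w2 sM.
  have -> : x = x1 + x2.
    by apply: (@par_uniq _ b _ z _ (z1 + z2)) => //; rewrite ?memvD // addrACA -E1 -E2.
  rewrite E1 in w1W; rewrite E2 in w2W.
  by apply: memv_add; [exact: cl1 x1M z1M w1W|exact: cl2 x2M z2M w2W].
by move/memv_addP=> [w1 w1W [w2 w2W ->]]; rewrite linearD memv_add ?st1 ?st2.
Qed.

Lemma submod0 M : superspace M -> submod (0%VS : {vspace M}).
Proof.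
move=> sM; split=> [b x z xM zM|g u]; rewrite !memv0.
  move=> /eqP E; apply/eqP; apply: (@par_uniq _ b _ z _ 0) => //; rewrite ?mem0v //.
  by rewrite addr0.
by move/eqP->; rewrite linear0.
Qed.

Lemma submod_sum M (I : finType) (A : {pred I}) (F : I -> {vspace M}) :
  superspace M -> (forall i, submod (F i)) -> submod (\sum_(i in A) F i)%VS.
Proof.
move=> sM sF; apply: (big_ind (fun X => submod X)) => //; first exact: submod0.
by move=> W1 W2; apply: submod_add.
Qed.

Lemma submod_img M N p (f : 'Hom(M, N)) W : superspace M -> superspace N ->
  shom p f -> submod W -> submod (f @: W)%VS.
Proof.
move=> sM sN [fg fp] [cl st]; split=> [b x z xN zN|g _ /memv_imgP[u uW ->]].
  move/memv_imgP=> [w wW E]; have [w0 [w1 [w0M w1M wE]]] := par_split (b (+) p) w sM.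
  have -> : x = f w0.
    apply: (@par_uniq _ b _ z _ (f w1)) => //; last by rewrite E wE linearD.
      by rewrite -[b](addbK p); apply: fp.
    by rewrite -[~~ b](addbK p) addNb; apply: fp.
  by rewrite memv_img //; rewrite wE in wW; apply: cl w0M w1M wW.
by rewrite -fg memv_img // st.
Qed.

Lemma submod_preim M N p (f : 'Hom(M, N)) W : superspace N ->
  shom p f -> submod W -> submod (f @^-1: W)%VS.
Proof.
move=> sN [fg fp] [cl st]; split=> [b x z xM zM|g u]; rewrite -!memv_preim.
  by rewrite linearD; apply: cl (fp _ _ xM) _; rewrite -addNb; apply: fp.
by move=> uW; rewrite fg st.
Qed.

Lemma submod_cap M (W1 W2 : {vspace M}) : submod W1 -> submod W2 -> submod (W1 :&: W2)%VS.
Proof.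
move=> [cl1 st1] [cl2 st2]; split=> [b x z xM zM /memv_capP[]|g u /memv_capP[]].
  by move=> h1 h2; apply/memv_capP; split; [exact: cl1 xM zM h1|exact: cl2 xM zM h2].
by move=> h1 h2; apply/memv_capP; rewrite st1 ?st2.
Qed.

Lemma shom_embedding M N p (f : 'Hom(M, N)) : shom p f -> lker f = 0%VS -> embedding f.
Proof.
case=> fg fp k0; split=> //; case: p fp => fp; [right|left]; split;
  apply/subvP => _ /memv_imgP[u uM ->].
- exact: (fp false).
- exact: (fp true).
- exact: (fp false).
exact: (fp true).
Qed.

Lemma embedding_shom M N (f : 'Hom(M, N)) : embedding f -> exists p, shom p f.
Proof.
case=> _ fg [] [/subvP fe /subvP fo]; [exists false|exists true]; split=> // b x xM;
  by case: b xM => /= xM; [apply: fo|apply: fe]; apply: memv_img.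
Qed.

Lemma shom_comp M N V p q (f : 'Hom(M, N)) (h : 'Hom(N, V)) :
  shom p f -> shom q h -> shom (p (+) q) (h \o f)%VF.
Proof.
move=> [fg fp] [hg hp]; split=> [g x|b x xM]; rewrite !comp_lfunE ?fg ?hg //.
by rewrite addbA; apply/hp/fp.
Qed.

(** Take a maximal partial sum of translates that meets the image of [h] trivially.
    The image lies in its sum with any further translate, which is direct, and the
    projection to that translate, pulled back to [W], is the isomorphism. *)
Lemma simple_in_translates M V (W : {vspace M}) (I : finType) (psi : I -> 'End(M))
    (h : 'Hom(V, M)) :
  superspace M -> superspace V -> submod W ->
  (forall W' : {vspace M}, submod W' -> (W' <= W)%VS -> W' = 0%VS \/ W' = W) ->
  (forall i, exists p, shom p (psi i)) -> (forall i, lker (psi i) = 0%VS) ->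
  (\sum_i psi i @: W)%VS = fullv ->
  (fullv : {vspace V}) <> 0%VS ->
  (forall V' : {vspace V}, submod V' -> V' = 0%VS \/ V' = fullv) ->
  embedding h ->
  isomorphic_to_submodule V W.
Proof.
move=> sM sV sW irrW psiH psiK psiW V0 irrV emb.
have [q hH] := embedding_shom emb; have [hK _ _] := emb.
pose S (A : {set I}) := (\sum_(i in A) psi i @: W)%VS.
have sS A : submod (S A).
  by apply: submod_sum => // i; have [p pH] := psiH i; apply: submod_img pH _.
pose good A := (limg h :&: S A == 0)%VS.
have good0 : good set0 by rewrite /good /S big_set0 capv0.
have [A /maxsetP[gA maxA] _] := maxset_exists good0.
have h_inj x : h x = 0 -> x = 0.
  by move=> hx; apply/eqP; rewrite -memv0 -hK memv_ker hx.
have [i iA] : exists i, i \notin A.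
  apply/existsP; apply: contraT; rewrite negb_exists => /forallP allA.
  have SA : S A = fullv.
    rewrite -psiW; apply: eq_bigl => i; have := allA i; rewrite negbK => ->.
    by [].
  move: gA; rewrite /good SA capvf => /eqP h0; case: V0.
  apply/eqP; rewrite -subv0; apply/subvP => x _; rewrite memv0; apply/eqP/h_inj/eqP.
  by rewrite -memv0 -h0 memv_img // memvf.
have [p pH] := psiH i.
have SiA : S (i |: A) = (psi i @: W + S A)%VS by rewrite /S big_setU1.
have hS x : h x \in (psi i @: W + S A)%VS.
  have sP : submod (h @^-1: S (i |: A))%VS by apply: submod_preim hH _.
  rewrite -SiA memv_preim; case: (irrV _ sP) => [P0|->]; last exact: memvf.
  have gi : good (i |: A).
    rewrite /good -subv0; apply/subvP => u /memv_capP[/memv_imgP[w _ ->] hw].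
    by rewrite memv0 (_ : w = 0) ?linear0 //; apply/eqP; rewrite -memv0 -P0 -memv_preim.
  by case/negP: iA; rewrite -(maxA _ gi (subsetU1 _ _)) !inE eqxx.
have dir : (psi i @: W :&: S A)%VS = 0%VS.
  have sK : submod (psi i @^-1: S A :&: W)%VS.
    by apply: submod_cap => //; apply: submod_preim pH _.
  case: (irrW _ sK (capvSr _ _)) => KE.
    apply/eqP; rewrite -subv0; apply/subvP => u /memv_capP[/memv_imgP[w wW ->] hw].
    rewrite memv0 (_ : w = 0) ?linear0 //; apply/eqP; rewrite -memv0 -KE.
    by rewrite memv_cap -memv_preim hw.
  have gi : good (i |: A).
    rewrite /good SiA; suff -> : (psi i @: W + S A)%VS = S A by [].
    apply/addv_idPr/subvP => _ /memv_imgP[w wW ->]; rewrite memv_preim.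
    by have : w \in W by []; rewrite -{1}KE => /memv_capP[].
  by case/negP: iA; rewrite -(maxA _ gi (subsetU1 _ _)) !inE eqxx.
pose f : 'Hom(V, M) := ((psi i)^-1 \o (daddv_pi (psi i @: W) (S A) \o h))%VF.
have fP x : f x \in W /\ h x - psi i (f x) \in S A.
  have aW := memv_pi (psi i @: W)%VS (S A) (h x).
  have /memv_imgP[w wW aE] := aW.
  have fE : f x = w by rewrite !comp_lfunE aE lker0_lfunK // psiK.
  rewrite fE -aE; split=> //.
  by rewrite -{1}(daddv_pi_add dir (hS x)) addrAC subrr add0r memv_pi.
have f_uniq x w : w \in W -> h x - psi i w \in S A -> f x = w.
  move=> wW hw; have [fW hf] := fP x; apply/eqP; rewrite -subr_eq0.
  rewrite -memv0 -(psiK i) memv_ker -memv0 -dir memv_cap memv_img ?memvB //=.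
  have -> : psi i (f x - w) = (h x - psi i w) - (h x - psi i (f x)).
    by rewrite linearB opprB [RHS]addrC addrA subrK.
  by rewrite memvB.
have fH : shom (q (+) p) f.
  have [pg pp] := pH; have [hg hp] := hH; have [clS stS] := sS A; have [clW stW] := sW.
  split=> [g x|b x xV]; have [fW hf] := fP x.
    by apply: f_uniq; rewrite ?stW // hg pg -linearB stS.
  have [w0 [w1 [w0M w1M wE]]] := par_split (b (+) (q (+) p)) (f x) sM.
  suff -> : f x = w0 by [].
  rewrite wE in fW hf; apply: f_uniq; first exact: clW w0M w1M fW.
  have hE : b (+) (q (+) p) (+) p = b (+) q by rewrite -!addbA addbb addbF.
  rewrite linearD opprD addrA in hf; apply: (clS (b (+) q)) hf.
    by rewrite memvB ?hp // -hE pp.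
  by rewrite memvN -hE -addNb pp.
have fK : lker f = 0%VS.
  apply/eqP; rewrite -subv0; apply/subvP => x; rewrite memv_ker => /eqP fx.
  have [_] := fP x; rewrite fx linear0 subr0 => hx.
  rewrite memv0; apply/eqP/h_inj/eqP; rewrite -memv0 -(eqP gA).
  by rewrite memv_cap memv_img ?memvf.
exists f; first exact: shom_embedding fH fK.
have sF : submod (limg f).
  apply: submod_img fH _ => //; split=> [b x z _ _ _|g u _]; exact: memvf.
have fW : (limg f <= W)%VS by apply/subvP => _ /memv_imgP[x _ ->]; case: (fP x).
case: (irrW _ sF fW) => // F0; case: V0.
apply/eqP; rewrite -subv0 -fK; apply/subvP => x _; rewrite memv_ker -memv0 -F0.
by rewrite memv_img ?memvf.
Qed.

End Supermodules.

(** * Irreducibility and identification with V^lambda *)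

Section Irreducibility.
Variables (C : numClosedFieldType) (n : nat) (lam : seq nat).
Hypothesis hlam : strict_partition n lam.
Local Notation Cl := (Cl C n).
Local Notation c := (cgen C n).
Local Notation U := (Uspace C n lam).
Local Notation Uh := (Uhat C n lam).
Local Notation M := (res_spin Uh).
Local Notation v := (vvec C lam).
Local Notation theta := (theta C lam).
Local Notation Fd := (@Fdelta C n lam).
Local Notation delta := (delta_index n lam).
Local Notation bv := (@basis_vector C n lam).
Local Notation W := (basis_span C n lam).
Local Notation spin_op := (@spin_op C n lam).
Local Notation jm := (@jm C n lam).
Local Notation uhat := (@uhat C n lam).
Implicit Types (x z : Cl) (u : U) (a : 'I_n.-1) (b : 'I_n) (dl : delta) (A : {set 'I_n}).

Lemma superspace_Uhat : superspace M.
Proof. by split; [apply: Uhat_full|apply: Uhat_cap]. Qed.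

Lemma parP (s : bool) u : reflect (uhat u = (-1) ^+ s *: u) (u \in par M s).
Proof.
case: s; rewrite ?scaleN1r ?scale1r /par /=; [exact: oddP|exact: evenP].
Qed.

Lemma submod_uhat (W' : {vspace M}) u : submod W' -> u \in W' -> uhat u \in W'.
Proof.
case=> cl _ uW; have [x [z [xM zM uE]]] := par_split (M := M) false u superspace_Uhat.
have xW : x \in W' by apply: cl xM zM _; rewrite -uE.
have zW : z \in W' by rewrite -(addKr x z) -uE memvD // memvN.
rewrite uE uhatD; move/(parP false): xM => ->; move/(parP true): zM => ->.
by rewrite scale1r scaleN1r memvB.
Qed.

(** The recursion [X_(a+1) = sqrt 2 t_a - t_a X_a t_a] expresses the Jucys-Murphy
    elements in terms of the generators. *)
Lemma submod_jm (W' : {vspace M}) b u : submod W' -> u \in W' -> jm b u \in W'.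
Proof.
move=> [_ st]; case: b => b; elim: b u => [|b IH] u lb uW.
  by rewrite (jm_first hlam) ?mem0v.
have lb' : (b < n.-1)%N by lia.
pose a := Ordinal lb'.
have -> : Ordinal lb = entry1 a by apply: val_inj.
have -> : jm (entry1 a) u = sqrtC 2 *: spin_op a u - spin_op a (jm (entry0 a) (spin_op a u)).
  by rewrite -(spin_op_jm hlam a (spin_op a u)) (spin_op_sqr hlam) addrAC subrr add0r.
have tW w : w \in W' -> spin_op a w \in W' by apply: st.
have -> : entry0 a = Ordinal (ltnW lb) by apply: val_inj.
by rewrite memvB ?memvZ ?tW ?IH ?tW.
Qed.

Lemma submod_basis_span : submod (W : {vspace M}).
Proof.
apply/(graded_submoduleP _ superspace_Uhat); split; last first.
  by move=> a; apply/subvP => _ /memv_imgP[u uW ->]; apply: (basis_span_stable hlam).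
apply: subv_anti; rewrite subv_add !capvSl /= andbT.
apply/span_subvP => _ /codomP[[dl T] ->].
have bW : bv (dl, T) \in W by rewrite memv_span ?codom_f.
have : bv (dl, T) \in par M (odd (delta_parity dl + inversions (val T))).
  by apply/parP; rewrite uhat_basis // signr_odd.
case: odd => bM; last by apply: (subvP (addvSl _ _)); rewrite memv_cap bW.
by apply: (subvP (addvSr _ _)); rewrite memv_cap bW.
Qed.

Lemma submod_flip (W' : {vspace M}) dl0 dl T : submod W' ->
  bv (dl0, T) \in W' -> bv (dl, T) \in W'.
Proof.
move=> sW W0; move: dl.
apply: (dflip_ind (dl0 := dl0) (P := fun dl => bv (dl, T) \in W')) => // dl j lj bW.
 have [b [k k0 E]] := jm_flip C hlam dl T lj.
by have := submod_jm b sW bW; rewrite E rpredZeq (negPf k0).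
Qed.

(** Applying [t_a] and removing the diagonal term leaves a nonzero multiple of the
    vectors of the tableau [s_a T]. *)
Lemma submod_swap (W' : {vspace M}) a (T T' : stdtab n lam) : submod W' ->
  val T' = swap a (val T) ->
  (forall dl, bv (dl, T) \in W') -> forall dl, bv (dl, T') \in W'.
Proof.
move=> sW T'E TW dl.
have EW x : x \in Espan C n lam -> clact x (theta (val T)) \in W'.
  move=> /span_codomP[k ->]; rewrite clact_suml; apply: memv_suml => dl' _.
  by rewrite clactZl memvZ // -basis_vectorE.
have : spin_op a (bv (dl, T)) \in W' by apply: (proj2 sW).
rewrite (spin_op_basis C hlam) rpredZeq signr_eq0 /= -T'E -basis_vectorE.
rewrite rpredDl ?EW ?(Espan_t_coef hlam) ?Fdelta_in //.
rewrite rpredZeq mulf_eq0 signr_eq0 /= (Ycoef_eq0 C hlam) ?(valP T) //.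
by rewrite -T'E (valP T').
Qed.

(** The components of a nonzero vector give one basis vector up to a scalar; the
    Jucys-Murphy elements then reach all [delta], and the [t_a] all tableaux. *)
Lemma basis_span_irreducible (W' : {vspace M}) : submod W' -> (W' <= W)%VS ->
  W' = 0%VS \/ W' = W.
Proof.
move=> sW W'W; have [->|nW] := eqVneq W' 0%VS; [by left|right].
have uW := memv_pick W'; have : vpick W' != 0 by rewrite vpick0.
have /span_codomP[k uE] := subvP W'W _ uW.
rewrite uE => u0.
have kW i : k i *: bv i \in W'.
  apply: (basis_separation hlam); last by rewrite -uE.
    by move=> b u; apply: submod_jm.
  by move=> u; apply: submod_uhat.
have [[dl0 T0] k0] : exists i, k i != 0.
  apply/existsP; apply: contraNT u0; rewrite negb_exists => /forallP k0.
  by apply/eqP/big1 => i _; have := k0 i; rewrite negbK => /eqP->; rewrite scale0r.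
have T0W dl : bv (dl, T0) \in W'.
  by apply: (@submod_flip _ dl0) => //; have := kW (dl0, T0); rewrite rpredZeq (negPf k0).
(* [step] applies in both directions, so every standard tableau is linked to the
   row tableau, the identity. *)
pose all_in d := forall std : standard lam d, forall dl, bv (dl, Sub d std) \in W'.
have step a d (std : standard lam d) (stds : standard lam (swap a d)) :
    all_in d -> all_in (swap a d).
  move=> dW std' dl; apply: (submod_swap (T := Sub d std) (a := a)) => //.
have to_id d : standard lam d -> (all_in d <-> all_in 1%g).
  elim/descent_ind: d => [|a d asc IH] stds; first by [].
  have std : standard lam d.
    by rewrite -(swapK a d) (standard_descent hlam) // ascent_swap asc.
  have [IH1 IH2] := IH std; split=> h; last exact: step (IH2 h).
  by apply: IH1; rewrite -(swapK a d); apply: step; rewrite ?swapK.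
have id_in : all_in 1%g.
  apply/(to_id _ (valP T0)) => std dl.
  by have -> : Sub (val T0) std = T0 by apply: val_inj.
apply: subv_anti; rewrite W'W; apply/span_subvP => _ /codomP[[dl T] ->].
have -> : T = Sub (val T) (valP T) by apply: val_inj.
exact: (proj2 (to_id _ (valP T)) id_in).
Qed.

(** The square of the map [u |-> t_a (uhat u)] commutes with the Clifford algebra, so
    that its value [-1] can be read off on the [v_T]. *)
Lemma uhat_spin_op a u : uhat (spin_op a u) = - spin_op a (uhat u).
Proof.
have E w : spin_op a (uhat (spin_op a (uhat w))) = - 1 *: w.
  move: w; apply: clact_additive_eq => [w w'|x w|[d std] /=].
  - by rewrite !(uhatD, linearD).
  - by rewrite uhat_clact spin_op_clact uhat_clact spin_op_clact !clhatK.
  have [la lb] := entry_ltn a.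
  have -> : uhat (v d) = v d by exact: uhat_vvec.
  suff -> : uhat (spin_op a (v d)) = - spin_op a (v d).
    by rewrite linearN /= (spin_op_sqr hlam) scaleN1r.
  rewrite (spin_op_vvec C hlam) // uhatD uhatZ !uhat_clact !uhat_vvec clhat_tau clhat_ygen //.
  by rewrite !clactNl scalerN opprD.
have := congr1 (spin_op a) (E (uhat u)).
by rewrite (spin_op_sqr hlam) uhatK scaleN1r linearN /=.
Qed.

(** Left multiplication by a Clifford monomial, composed with the parity involution
    for an odd monomial so that it commutes with the [t_a]. *)
Definition translate_fun A u : U := clact (clbasis C A) (if odd #|A| then uhat u else u).

Lemma translate_linear A : linear (translate_fun A).
Proof.
move=> k u w; rewrite /translate_fun; case: odd; last exact: clact_linear.
by rewrite uhatD uhatZ; apply: clact_linear.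
Qed.

Definition translate A : 'End(U) := linfun (translate_fun A).

Lemma translateE A u : translate A u = translate_fun A u.
Proof.
pose L := GRing.isLinear.Build C U U *:%R _ (translate_linear A).
pose f : {linear U -> U} := HB.pack (translate_fun A) L.
exact: (lfunE f).
Qed.

Lemma translate_shom A : shom (M := M) (N := M) (odd #|A|) (translate A).
Proof.
split=> [a u|s u /parP uE].
  change (translate A (spin_op a u) = spin_op a (translate A u)).
  rewrite !translateE /translate_fun; case: ifP => Ao; rewrite spin_op_clact clhat_basis -signr_odd Ao.
    by rewrite scaleN1r clactNl uhat_spin_op -[- spin_op a _]scaleN1r clactZr scaleN1r.
  by rewrite scale1r.
apply/parP; rewrite translateE /translate_fun uhat_clact clhat_basis -signr_odd.
by rewrite signr_addb mulrC clactZl -scalerA; case: odd; rewrite ?uhatK uE ?clactZr ?signZK.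
Qed.

Lemma translate_inj A : lker (translate A) = 0%VS.
Proof.
apply/eqP; rewrite -subv0; apply/subvP => u; rewrite memv_ker translateE => /eqP uA.
have s0 : clsign C A A != 0.
  by apply/eqP => s0; have := clsign_sqr C A A; rewrite s0 mul0r => /esym/eqP; rewrite oner_eq0.
have : clact (clbasis C A) (translate_fun A u) = 0 by rewrite uA clact0r.
rewrite /translate_fun clactM clbasisM symdiffss clactZl clact1l => /eqP.
rewrite scaler_eq0 (negPf s0) /= memv0; case: ifP => // _ /eqP u0.
by rewrite -[u]uhatK u0 uhat0.
Qed.

(** The [F^delta] generate the Clifford algebra as a left ideal, and [Theta d] is
    invertible. *)
Lemma translates_full : (\sum_A translate A @: W)%VS = fullv.
Proof.
set S := (\sum_A _)%VS; apply/eqP; rewrite eqEsubv subvf; apply/subvP => u _.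
pose L x := forall z (T : stdtab n lam), clact (z * x) (theta (val T)) \in S.
have S1 : L 1.
  apply: (Fdelta_generate hlam).
  - by move=> x x' xS x'S z T; rewrite mulrDr clactDl memvD.
  - by move=> x x' x'S z T; rewrite mulrA.
  move=> dl z T; rewrite -clactM -basis_vectorE [z]clbasis_expand clact_suml.
  apply: memv_suml => A _; rewrite clactZl memvZ //.
  apply: (subvP (sumv_sup A _ (subvv _))) => //.
  have : translate A (bv (dl, T)) \in (translate A @: W)%VS.
    by rewrite memv_img // memv_span // codom_f.
  rewrite translateE /translate_fun; case: ifP => // _.
  by rewrite (uhat_basis C hlam) clactZr rpredZeq signr_eq0.
rewrite [u]Uspace_expand; apply: memv_suml => T _.
have [z _ zT] := Theta_inv C (val T).
by have := S1 (u T * z) T; rewrite mulr1 thetaE clactM -mulrA zT mulr1.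
Qed.

Lemma irreducible_basis_span : irreducible_submodule (W : {vspace M}).
Proof.
split; first exact/(graded_submoduleP _ superspace_Uhat)/submod_basis_span.
  exact: basis_span_neq0.
by move=> W' /(graded_submoduleP _ superspace_Uhat); apply: basis_span_irreducible.
Qed.

(** [V] embeds into a model of [U^lambda], and the latter into [Uhat], which is the
    sum of the translates of [W]. *)
Lemma Vlambda_basis_span (V : superRep C 'I_n.-1) : is_Vlambda lam V ->
  isomorphic_to_submodule V (W : {vspace M}).
Proof.
case=> -[[Vfull Vcap _ _] _] [_ V0 Virr] [X [_ _ [k [F [Femb _ Fsum]]]] [f [fK ft fp]]].
have k0 : (0 < k)%N.
  case: k F Femb Fsum => // F _; rewrite big_ord0 => F0.
  case: (basis_span_neq0 (C := C) hlam); apply/eqP; rewrite -subv0.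
  by apply/subvP => u _; move: (memvf (u : Uh)); rewrite -F0.
pose F0 : 'Hom(X, M) := F (Ordinal k0).
have [F0K F0t F0p] := Femb (Ordinal k0).
have sV : superspace V by [].
apply: (@simple_in_translates _ _ M V W _ translate (F0 \o f)%VF) => //.
- exact: superspace_Uhat.
- exact: submod_basis_span.
- exact: basis_span_irreducible.
- by move=> A; exists (odd #|A|); apply: translate_shom.
- exact: translate_inj.
- exact: translates_full.
- move=> V' /(graded_submoduleP _ sV) gV'; apply: Virr => //; exact: subvf.
have [p pH] := embedding_shom (And3 fK ft fp : embedding (f : 'Hom(V, res_spin X))).
have [q qH] : exists q, shom (M := res_spin X) (N := M) q F0.
  by apply: embedding_shom; split=> // a x; apply: F0t.
apply: (shom_embedding (shom_comp pH qH)).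
apply/eqP; rewrite -subv0; apply/subvP => x; rewrite memv_ker comp_lfunE.
move=> F0x; have : f x \in lker (F (Ordinal k0)) by rewrite memv_ker.
rewrite F0K => fx0; have fx : f x = 0 by apply/eqP; rewrite -memv0.
by rewrite -fK memv_ker fx.
Qed.

End Irreducibility.

Theorem theorem3p7 (R : realType) (n : nat) (lam : seq nat)
    (hlam : strict_partition n lam) :
  let C : numClosedFieldType := R[i] in
  let Uh := Uhat C n lam in
  let t (a : 'I_n.-1) (u : Uh) : Uh := rep_op Uh (inl a) u in
  let c (b : 'I_n) (u : Uh) : Uh := rep_op Uh (inr b) u in
  [/\ basis_of (basis_span C n lam) (codom (@basis_vector C n lam)),
      @irreducible_submodule C 'I_n.-1 (res_spin Uh) (basis_span C n lam) &
      forall V : superRep C 'I_n.-1, is_Vlambda lam V ->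
        @isomorphic_to_submodule C 'I_n.-1 V (res_spin Uh) (basis_span C n lam)]
  /\
  [/\ forall (a : 'I_n.-1) (b : 'I_n) (u : Uh), t a (c b u) = - c b (t a u),
      (forall (x : Cl C n) (b : 'I_n), x \in Espan C n lam ->
          b \in nondiag n lam -> x * cgen C n b \in Espan C n lam)
      /\ (forall a : 'I_((n - size lam)./2),
          [/\ Fplus C n lam a * (cb C n lam)`_(a.*2) = Fminus C n lam a,
              Fplus C n lam a * (cb C n lam)`_(a.*2.+1)
                = - 'i *: Fminus C n lam a,
              Fminus C n lam a * (cb C n lam)`_(a.*2) = - Fplus C n lam a &
              Fminus C n lam a * (cb C n lam)`_(a.*2.+1)
                = - 'i *: Fplus C n lam a]),
      forall (a : 'I_n.-1) (T : stdtab n lam),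
        t a (theta C lam (val T))
        = clact (t_coef C lam a (val T)) (theta C lam (val T))
          + ((-1) ^+ eps_exponent a (val T) * Ycoef C lam a (val T))
              *: theta C lam (swap a (val T)) &
      (* the resulting action on the basis *)
      forall (a : 'I_n.-1) (dl : delta_index n lam) (T : stdtab n lam),
        Fdelta C dl * t_coef C lam a (val T) \in Espan C n lam
        /\ t a (basis_vector C (dl, T))
           = (-1) ^+ delta_parity dl *:
             (clact (Fdelta C dl * t_coef C lam a (val T)) (theta C lam (val T))
              + ((-1) ^+ eps_exponent a (val T) * Ycoef C lam a (val T))
                  *: clact (Fdelta C dl) (theta C lam (swap a (val T))))].
Proof.
move=> C Uh t c; split; split.
- exact: basis_of_basis_span.
- exact: irreducible_basis_span.
- by move=> V; apply: Vlambda_basis_span.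
- move=> a b u; rewrite /t /c !c_opE [LHS](spin_op_clact a (cgen C n b) u).
  by rewrite clhat_cgen // clactNl.
- split=> [x b xE bn|a]; first exact: Espan_cgen.
  have ap := ltn_ord a.
  split; [exact: Fplus_even|exact: Fplus_odd|exact: Fminus_even|exact: Fminus_odd].
- by move=> a T; apply: spin_op_theta => //; apply: valP.
move=> a dl T; split; first by apply: Espan_t_coef => //; apply: Fdelta_in.
exact: spin_op_basis.
Qed.
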